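(* Let $\Omega\subset\mathbb{R}^2$ be open and connected, let $H:\Omega\to\mathbb{R}$ be of class $C^3$, and let $V_H=(H_y,-H_x)$ be the vector field of the Hamiltonian system $x'=H_y$, $y'=-H_x$. Let $A\subset\Omega$ be a period annulus of this system. If $|\nabla H|\neq 0$ on $A$, then the vector field $$W_H=\left(\frac{H_x}{|\nabla H|^2},\ \frac{H_y}{|\nabla H|^2}\right)$$ is a normalizer of $V_H$ on $A$, that is $[V_H,W_H]=\mu_H V_H$ on $A$, with $$\mu_H=\operatorname{div} W_H=\frac{(H_{yy}-H_{xx})H_x^2-4H_{xy}H_xH_y+(H_{xx}-H_{yy})H_y^2}{|\nabla H|^4},$$ and, for every value $h\in H(A)$, $$T'(h)=\int_0^{T(h)}\mu_H(\gamma_h(t))\,dt,$$ where $T(h)$ is the minimal period of the cycle $A\cap H^{-1}(h)$ and $\gamma_h(t)$ is a solution of the Hamiltonian system parametrizing that cycle.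
   Context: A period annulus of a planar system $z'=V(z)$, $z\in\Omega$, is an open connected set $A\subset\Omega$ that is a union of orbits of $V$, all of which are non-trivial cycles (non-constant periodic orbits). The period function $T$ assigns to $z\in A$ the minimal period of the cycle through $z$. If $\nabla H\ne0$ on $A$, every cycle in $A$ is the level set of $H$ in $A$ (of the form $A\cap H^{-1}(h)$), so the period function is a function of the value of $H$, denoted $T(H)$; $T'$ denotes its derivative with respect to that value. For vector fields $V,U$, the Lie bracket is $[V,U]=\partial_V U-\partial_U V$, where $\partial_V U$ is the directional derivative of $U$ along $V$ (i.e. $(DU)V$). For planar vectors, $V\wedge U=V_1U_2-V_2U_1$. A vector field $U$ is a normalizer of $V$ on $A$ if $[V,U]\wedge V=0$ on $A$; it is non-trivial if it is moreover transversal to $V$ (i.e. $V\wedge U\neq0$ on $A$). Where $V$ does not vanish, $U$ is a normalizer iff $[V,U]=\mu V$ with $\mu=\frac{[V,U]\cdot V}{|V|^2}$. *)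

(* Defs.v *)
From Stdlib Require Import Reals ClassicalEpsilon.
From Coquelicot Require Import Coquelicot.
Open Scope R_scope.

Definition subset (A B : R * R -> Prop) : Prop := forall z, A z -> B z.

Definition connected (A : R * R -> Prop) : Prop :=
  forall U W : R * R -> Prop,
    open U -> open W ->
    (forall z, A z -> U z \/ W z) ->
    (exists z, A z /\ U z) -> (exists z, A z /\ W z) ->
    exists z, A z /\ U z /\ W z.

Definition dx (f : R * R -> R) (z : R * R) : R :=
  Derive (fun x => f (x, snd z)) (fst z).
Definition dy (f : R * R -> R) (z : R * R) : R :=
  Derive (fun y => f (fst z, y)) (snd z).

(** Functions are total; [is_Ck k D f] only constrains [f] on the set [D], which
    is meant to be open. *)
Fixpoint is_Ck (k : nat) (D : R * R -> Prop) (f : R * R -> R) : Prop :=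
  (forall z, D z -> continuous f z) /\
  match k with
  | O => True
  | S k' =>
      (forall z, D z -> ex_derive (fun x => f (x, snd z)) (fst z)
                        /\ ex_derive (fun y => f (fst z, y)) (snd z)) /\
      is_Ck k' D (dx f) /\ is_Ck k' D (dy f)
  end.

(** Lie bracket with the sign convention [V,U] = (DU)V - (DV)U. *)
Definition dir_deriv (V U : R * R -> R * R) (z : R * R) : R * R :=
  (dx (fun w => fst (U w)) z * fst (V z) + dy (fun w => fst (U w)) z * snd (V z),
   dx (fun w => snd (U w)) z * fst (V z) + dy (fun w => snd (U w)) z * snd (V z)).

Definition bracket (V U : R * R -> R * R) (z : R * R) : R * R :=
  minus (dir_deriv V U z) (dir_deriv U V z).

Definition wedge (v u : R * R) : R := fst v * snd u - snd v * fst u.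

Definition normalizer (A : R * R -> Prop) (V U : R * R -> R * R) : Prop :=
  forall z, A z -> wedge (bracket V U z) (V z) = 0.

Definition divergence (U : R * R -> R * R) (z : R * R) : R :=
  dx (fun w => fst (U w)) z + dy (fun w => snd (U w)) z.

Definition is_solution (Om : R * R -> Prop) (V : R * R -> R * R)
    (g : R -> R * R) : Prop :=
  forall t, Om (g t) /\ is_derive g t (V (g t)).

Definition periodic (g : R -> R * R) (s : R) : Prop :=
  forall t, g (t + s) = g t.

Definition minimal_period (g : R -> R * R) (tau : R) : Prop :=
  0 < tau /\ periodic g tau /\ forall s, 0 < s -> periodic g s -> tau <= s.

Definition orbit (g : R -> R * R) : R * R -> Prop :=
  fun z => exists t, g t = z.

Definition nontrivial_cycle (Om : R * R -> Prop) (V : R * R -> R * R)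
    (C : R * R -> Prop) : Prop :=
  exists g : R -> R * R,
    is_solution Om V g /\
    (exists s, 0 < s /\ periodic g s) /\
    (exists t, g t <> g 0) /\
    (forall z, C z <-> orbit g z).

Definition period_annulus (Om : R * R -> Prop) (V : R * R -> R * R)
    (A : R * R -> Prop) : Prop :=
  open A /\ connected A /\ subset A Om /\
  forall z, A z -> exists C, nontrivial_cycle Om V C /\ C z /\ subset C A.

Definition grad (H : R * R -> R) (z : R * R) : R * R := (dx H z, dy H z).

Definition V_H (H : R * R -> R) (z : R * R) : R * R := (dy H z, - dx H z).

(** [norm] on [R * R] is the Euclidean norm. *)
Definition W_H (H : R * R -> R) (z : R * R) : R * R :=
  (dx H z / norm (grad H z) ^ 2, dy H z / norm (grad H z) ^ 2).

Definition mu_H (H : R * R -> R) : R * R -> R := divergence (W_H H).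

(** The period as a function of the value [h] of [H]: the minimal period of a
    cycle in [A] on which [H = h].  When the gradient of [H] does not vanish on
    [A] there is only one such cycle; outside [H(A)] the value is arbitrary. *)
Definition period_fun (Om : R * R -> Prop) (H : R * R -> R)
    (A : R * R -> Prop) (h : R) : R :=
  epsilon (inhabits 0) (fun tau =>
    exists g : R -> R * R,
      is_solution Om (V_H H) g /\ A (g 0) /\ H (g 0) = h /\
      minimal_period g tau).

(* Main.v *)
Require Import Defs.
From Stdlib Require Import Reals Ranalysis5 Lra Classical ClassicalEpsilon.
From Coquelicot Require Import Coquelicot.
Open Scope R_scope.

(** The bracket identity and the formula for [mu_H] are computations with second
    derivatives, using the symmetry of the Hessian.  The content is the formula
    for the derivative of the period.

    Let [g] be a cycle of period [T] on the level [h].  For [h'] close to [h],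
    each point [g t] is moved along the straight line directed by the gradient
    of [H] at [g t], until the level [h'] is reached.  This gives a closed curve
    [c] on the level [h'], with the same parameter [t].  Since [c] stays on a
    level set, [c' = lam * V_H c] for a positive function [lam], so [c] is a
    reparametrization of the cycle through [c 0] ([displaced_cycle],
    [reparametrized_cycle]), whose period is therefore the integral of [lam] over
    [0, T].  Taking the wedge product of [c'] with the gradient at [g t] removes
    the derivative of the displacement and expresses [lam] in closed form, whence
    [lam t = 1 + (h' - h) * mu_H (g t) + o(h' - h)] uniformly in [t].
    Integration gives the derivative ([tube]).  The straight line may replace the
    orbits of [W_H] because it is tangent to [W_H] at the points of [g], and the
    formula involves only first-order variations.

    To read this as a statement about a function of [h], each level set of [H] in
    [A] must be a single cycle ([level_set_single_orbit]).  Displacing a cycle to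
    all nearby levels fills a neighbourhood of it, since a point [p] lies on the
    normal line at the point of the cycle nearest to [p].  Hence the
    cycles of [A] form a connected Hausdorff one-dimensional manifold on which
    [H] is locally injective.  Such a map to the line is injective: the domains
    on which it is injective with an interval as image ([tower]) can be glued as
    soon as they meet ([tower_union]), so they exhaust [A]. *)

(** * Calculus in the plane *)

Lemma is_Ck_pred (k : nat) (D : R * R -> Prop) (f : R * R -> R) :
  is_Ck (S k) D f -> is_Ck k D f.
Proof.
  revert f; induction k as [|k IH]; intros f [Hc [Hd [Hx Hy]]].
  - split; auto.
  - split; [exact Hc | split; [exact Hd | split; apply IH; assumption]].
Qed.

Lemma scal_pair (k : R) (l : R * R) : scal k l = (k * fst l, k * snd l).
Proof. now destruct l. Qed.

Lemma scal_one_pair (l : R * R) : scal 1 l = l.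
Proof. rewrite scal_pair. destruct l; simpl. f_equal; ring. Qed.

Lemma continuous_close {U : UniformSpace} (f : U -> R) (z : U) (e : R) :
  continuous f z -> 0 < e -> locally z (fun w => Rabs (f w - f z) < e).
Proof.
  intros Hf He.
  exact (Hf (ball (f z) (mkposreal e He)) (locally_ball _ (mkposreal e He))).
Qed.

Lemma continuous_ball {U : UniformSpace} (u : R -> U) (t e : R) :
  continuous u t -> 0 < e -> exists d, 0 < d /\
    forall s, Rabs (s - t) < d -> ball (u t) e (u s).
Proof.
  intros Hu He.
  destruct (Hu (ball (u t) (mkposreal e He)) (locally_ball _ (mkposreal e He)))
    as [d Hd].
  exists d. split; [apply cond_pos|]. intros s Hs. exact (Hd s Hs).
Qed.

Lemma continuous_eq_limit (u v : R -> R * R) (t : R) :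
  continuous u t -> continuous v t ->
  (forall e, 0 < e -> exists s, Rabs (s - t) < e /\ u s = v s) -> u t = v t.
Proof.
  intros Hu Hv He.
  apply eq_close. intros eps.
  destruct (continuous_ball u t (eps / 2) Hu ltac:(generalize (cond_pos eps); lra))
    as [d1 [Hd1 B1]].
  destruct (continuous_ball v t (eps / 2) Hv ltac:(generalize (cond_pos eps); lra))
    as [d2 [Hd2 B2]].
  destruct (He (Rmin d1 d2)) as [s [Hs E]].
  { now apply Rmin_pos. }
  replace (pos eps) with (eps / 2 + eps / 2) by field.
  apply ball_triangle with (u s).
  - apply B1. eapply Rlt_le_trans; [exact Hs|apply Rmin_l].
  - rewrite E. apply ball_sym, B2. eapply Rlt_le_trans; [exact Hs|apply Rmin_r].
Qed.

Lemma continuous_Rplus {U : UniformSpace} (f g : U -> R) (z : U) :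
  continuous f z -> continuous g z -> continuous (fun w => f w + g w) z.
Proof. apply @continuous_plus. Qed.

Lemma continuous_Rminus {U : UniformSpace} (f g : U -> R) (z : U) :
  continuous f z -> continuous g z -> continuous (fun w => f w - g w) z.
Proof. apply @continuous_minus. Qed.

Lemma continuous_Rmult {U : UniformSpace} (f g : U -> R) (z : U) :
  continuous f z -> continuous g z -> continuous (fun w => f w * g w) z.
Proof. apply @continuous_mult. Qed.

Lemma continuous_Rdiv {U : UniformSpace} (f g : U -> R) (z : U) :
  continuous f z -> continuous g z -> g z <> 0 ->
  continuous (fun w => f w / g w) z.
Proof.
  intros Hf Hg H0. apply continuous_Rmult; [exact Hf|].
  apply (continuous_comp g Rinv); [exact Hg|]. now apply continuous_Rinv.
Qed.

Lemma continuous_pair {U V W : UniformSpace} (f : U -> V) (g : U -> W) (z : U) :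
  continuous f z -> continuous g z -> continuous (fun w => (f w, g w)) z.
Proof.
  intros Hf Hg. apply filterlim_locally. intros e.
  assert (Lf : locally z (fun w => ball (f z) e (f w))) by exact (Hf _ (locally_ball (f z) e)).
  assert (Lg : locally z (fun w => ball (g z) e (g w))) by exact (Hg _ (locally_ball (g z) e)).
  generalize (filter_and _ _ Lf Lg). apply filter_imp.
  intros w [A B]. split; assumption.
Qed.

Lemma continuous_proj1 {U V : UniformSpace} (w : U * V) : continuous fst w.
Proof. destruct w; apply continuous_fst. Qed.

Lemma continuous_proj2 {U V : UniformSpace} (w : U * V) : continuous snd w.
Proof. destruct w; apply continuous_snd. Qed.

Lemma separated_nbhds (z w : R * R) :
  z <> w -> exists d, 0 < d /\
    forall z', ball z d z' -> forall p, ball z' d p -> ~ ball w d p.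
Proof.
  intros Hne. apply NNPP. intros Hn. apply Hne, eq_close. intros e.
  apply NNPP. intros Hb. apply Hn. exists (e / 3).
  split; [generalize (cond_pos e); lra|]. intros z' Hz p Hp Hw. apply Hb.
  replace (pos e) with (e / 3 + e / 3 + e / 3) by field.
  apply ball_triangle with p; [|now apply ball_sym].
  now apply ball_triangle with z'.
Qed.

Lemma open_ball_plane (z : R * R) (d : R) : open (ball z d).
Proof.
  assert (O1 : forall a, open (fun u : R => Rabs (u - a) < d)).
  { intros a. apply (open_comp (fun u => Rabs (u - a)) (fun v => v < d)).
    - intros u _. apply (continuous_comp (fun u => u - a) Rabs).
      + apply continuous_Rminus; [apply continuous_id|apply continuous_const].
      + apply continuous_Rabs.
    - apply open_lt. }
  apply (open_and (fun p : R * R => Rabs (fst p - fst z) < d)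
           (fun p : R * R => Rabs (snd p - snd z) < d)).
  - apply (open_comp fst (fun u => Rabs (u - fst z) < d)); [|apply O1].
    intros p _. apply continuous_proj1.
  - apply (open_comp snd (fun u => Rabs (u - snd z) < d)); [|apply O1].
    intros p _. apply continuous_proj2.
Qed.

Lemma is_derive_fst (g : R -> R * R) (t : R) (l : R * R) :
  is_derive g t l -> is_derive (fun s => fst (g s)) t (fst l).
Proof.
  intros Hg.
  exact (filterdiff_comp' g fst t _ _ Hg (filterdiff_linear _ is_linear_fst)).
Qed.

Lemma is_derive_snd (g : R -> R * R) (t : R) (l : R * R) :
  is_derive g t l -> is_derive (fun s => snd (g s)) t (snd l).
Proof.
  intros Hg.
  exact (filterdiff_comp' g snd t _ _ Hg (filterdiff_linear _ is_linear_snd)).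
Qed.

Lemma is_derive_pair (a b : R -> R) (t a' b' : R) :
  is_derive a t a' -> is_derive b t b' -> is_derive (fun s => (a s, b s)) t (a', b').
Proof.
  intros Ha Hb.
  apply (filterdiff_ext_lin _ (fun y : R => (scal y a', scal y b'))).
  - apply (filterdiff_comp_2 a b (fun x y => (x, y)) (fun y => scal y a') (fun y => scal y b')
             (fun x y => (x, y)) Ha Hb).
    apply (filterdiff_ext (fun p => p)); [now intros []|].
    apply (filterdiff_ext_lin _ (fun p => p)); [apply filterdiff_id|now intros []].
  - intros y. reflexivity.
Qed.

Lemma is_derive_continuous_pair (g : R -> R * R) (t : R) (l : R * R) :
  is_derive g t l -> continuous g t.
Proof.
  intros Hg.
  apply (@ex_derive_continuous R_AbsRing
           (prod_NormedModule R_AbsRing R_NormedModule R_NormedModule) g t).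
  now exists l.
Qed.

Lemma Derive_eta (f : R -> R) (x l : R) :
  is_derive f x l -> Derive (fun y : R => f y) x = l.
Proof. exact (is_derive_unique f x l). Qed.

Lemma is_derive_sum_squares (a b : R -> R) (t a' b' : R) :
  is_derive a t a' -> is_derive b t b' ->
  is_derive (fun s => a s * a s + b s * b s) t (2 * (a t * a' + b t * b')).
Proof.
  intros Ha Hb. auto_derive.
  - repeat split; eexists; eassumption.
  - rewrite (Derive_eta _ _ _ Ha), (Derive_eta _ _ _ Hb). ring.
Qed.

Lemma MVT_ball (f df : R -> R) (c e a b : R) :
  (forall s, Rabs (s - c) < e -> is_derive f s (df s)) ->
  Rabs (a - c) < e -> Rabs (b - c) < e ->
  exists s, Rabs (s - c) < e /\ Rmin a b <= s <= Rmax a b /\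
    f b - f a = df s * (b - a).
Proof.
  intros Hd Ha Hb.
  assert (Hin : forall s, Rmin a b <= s <= Rmax a b -> Rabs (s - c) < e).
  { intros s Hs. apply Rabs_def2 in Ha; apply Rabs_def2 in Hb.
    revert Hs; unfold Rmin, Rmax; destruct (Rle_dec a b); intros Hs;
      apply Rabs_def1; lra. }
  destruct (MVT_gen f a b df) as [s [Hs E]].
  - intros s Hs. apply Hd, Hin. lra.
  - intros s Hs. apply continuity_pt_filterlim, (ex_derive_continuous f).
    exists (df s). apply Hd, Hin, Hs.
  - exists s. auto.
Qed.

Lemma C1_is_derive_curve (D : R * R -> Prop) (f : R * R -> R) (x y : R -> R)
    (t x' y' : R) :
  open D -> is_Ck 1 D f -> D (x t, y t) ->
  is_derive x t x' -> is_derive y t y' ->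
  is_derive (fun s => f (x s, y s)) t
    (dx f (x t, y t) * x' + dy f (x t, y t) * y').
Proof.
  intros HD [Hc [Hd [[Hx _] [Hy _]]]] Hz Hx' Hy'.
  (* Continuity of one partial derivative near the point and existence of the
     other at the point suffice for differentiability. *)
  refine (filterdiff_ext_lin _ _ _
    (filterdiff_comp'_2 x y (fun a b => f (a, b)) t _ _
       (fun a b => plus (scal a (dx f (x t, y t)))
                        (scal b (dy f (x t, y t)))) Hx' Hy' _) _).
  - apply (is_derive_filterdiff (fun a b => f (a, b)) (x t) (y t)
             (fun a b => dx f (a, b)) (dy f (x t, y t))).
    + generalize (HD _ Hz). apply filter_imp. intros [a b] Hab. simpl.
      apply Derive_correct. exact (proj1 (Hd _ Hab)).
    + apply Derive_correct. exact (proj2 (Hd _ Hz)).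
    + eapply continuous_ext; [|exact (Hx _ Hz)].
      now intros [a b].
  - intros s. unfold plus, scal; simpl; unfold mult; simpl. ring.
Qed.

(** Balls of the plane are boxes here, so two points of a ball are joined inside it
    by a horizontal and a vertical segment, and the mean value theorem applies to
    each. *)
Lemma C1_locally_lipschitz (D : R * R -> Prop) (f : R * R -> R) (z : R * R) :
  open D -> is_Ck 1 D f -> D z ->
  exists K e : R, 0 < K /\ 0 < e /\ forall p q,
    ball z e p -> ball z e q ->
    Rabs (f p - f q) <= K * (Rabs (fst p - fst q) + Rabs (snd p - snd q)).
Proof.
  intros HD [Hc [Hd [[Hx _] [Hy _]]]] Hz.
  assert (L : locally z (fun w => D w /\
              Rabs (dx f w) < Rabs (dx f z) + Rabs (dy f z) + 1 /\
              Rabs (dy f w) < Rabs (dx f z) + Rabs (dy f z) + 1)).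
  { apply filter_and; [exact (HD _ Hz)|].
    apply filter_and.
    - generalize (continuous_close _ _ 1 (Hx z Hz) Rlt_0_1).
      apply filter_imp. intros w Hw.
      generalize (Rabs_triang_inv (dx f w) (dx f z)) (Rabs_pos (dy f z)). lra.
    - generalize (continuous_close _ _ 1 (Hy z Hz) Rlt_0_1).
      apply filter_imp. intros w Hw.
      generalize (Rabs_triang_inv (dy f w) (dy f z)) (Rabs_pos (dx f z)). lra. }
  destruct L as [e He].
  set (K := Rabs (dx f z) + Rabs (dy f z) + 1) in *.
  assert (HK : 0 < K).
  { unfold K. generalize (Rabs_pos (dx f z)) (Rabs_pos (dy f z)). lra. }
  exists K, e. split; [exact HK | split; [apply cond_pos|]].
  intros [p1 p2] [q1 q2] [Hp1 Hp2] [Hq1 Hq2]; simpl in *.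
  change (Rabs (p1 - fst z) < e) in Hp1. change (Rabs (p2 - snd z) < e) in Hp2.
  change (Rabs (q1 - fst z) < e) in Hq1. change (Rabs (q2 - snd z) < e) in Hq2.
  assert (B : forall a b, Rabs (a - fst z) < e -> Rabs (b - snd z) < e ->
            D (a, b) /\ Rabs (dx f (a, b)) < K /\ Rabs (dy f (a, b)) < K).
  { intros a b Ha Hb. apply (He (a, b)). split; assumption. }
  destruct (MVT_ball (fun s => f (s, p2)) (fun s => dx f (s, p2)) (fst z) e q1 p1)
    as [s [Hs [_ Es]]]; auto.
  { intros s Hs. apply Derive_correct. exact (proj1 (Hd _ (proj1 (B _ _ Hs Hp2)))). }
  destruct (MVT_ball (fun s => f (q1, s)) (fun s => dy f (q1, s)) (snd z) e q2 p2)
    as [u [Hu [_ Eu]]]; auto.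
  { intros u Hu. apply Derive_correct. exact (proj2 (Hd _ (proj1 (B _ _ Hq1 Hu)))). }
  replace (f (p1, p2) - f (q1, q2)) with
    ((f (p1, p2) - f (q1, p2)) + (f (q1, p2) - f (q1, q2))) by ring.
  rewrite Es, Eu.
  eapply Rle_trans; [apply Rabs_triang|]. rewrite !Rabs_mult, Rmult_plus_distr_l.
  apply Rplus_le_compat; apply Rmult_le_compat_r; try apply Rabs_pos; left; apply B; auto.
Qed.

(** Where [f] vanishes, the product rule asks only for continuity of the other
    factor. *)
Lemma is_derive_mult_vanishing (q f : R -> R) (t l : R) :
  f t = 0 -> is_derive f t l -> continuous q t ->
  is_derive (fun s => q s * f s) t (q t * l).
Proof.
  intros H0 Hf Hq. apply is_derive_Reals. apply is_derive_Reals in Hf.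
  intros eps Heps.
  assert (P1 : 0 < Rabs (q t) + 1) by (generalize (Rabs_pos (q t)); lra).
  assert (P2 : 0 < Rabs l + 1) by (generalize (Rabs_pos l); lra).
  assert (P3 : 0 < eps / (2 * (Rabs (q t) + 1))) by (apply Rdiv_lt_0_compat; lra).
  assert (P4 : 0 < eps / (2 * (Rabs l + 1))) by (apply Rdiv_lt_0_compat; lra).
  destruct (Hf _ P3) as [d1 Hd1].
  destruct (continuous_ball q t (Rmin 1 (eps / (2 * (Rabs l + 1)))) Hq
              ltac:(apply Rmin_pos; lra)) as [d2 [Hd2 Bd2]].
  exists (mkposreal (Rmin d1 d2) ltac:(apply Rmin_pos; [apply cond_pos|exact Hd2])).
  simpl. intros x Hx Hxd. rewrite H0.
  specialize (Hd1 x Hx (Rlt_le_trans _ _ _ Hxd (Rmin_l _ _))). rewrite H0 in Hd1.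
  assert (B : Rabs (q (t + x) - q t) < Rmin 1 (eps / (2 * (Rabs l + 1)))).
  { apply (Bd2 (t + x)). replace (t + x - t) with x by ring.
    exact (Rlt_le_trans _ _ _ Hxd (Rmin_r _ _)). }
  assert (B1 : Rabs (q (t + x) - q t) < 1) by exact (Rlt_le_trans _ _ _ B (Rmin_l _ _)).
  assert (B2 : Rabs (q (t + x) - q t) < eps / (2 * (Rabs l + 1)))
    by exact (Rlt_le_trans _ _ _ B (Rmin_r _ _)).
  replace ((q (t + x) * f (t + x) - q t * 0) / x - q t * l) with
    (q (t + x) * ((f (t + x) - 0) / x - l) + (q (t + x) - q t) * l) by (field; exact Hx).
  eapply Rle_lt_trans; [apply Rabs_triang|]. rewrite !Rabs_mult.
  assert (Q : Rabs (q (t + x)) <= Rabs (q t) + 1).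
  { generalize (Rabs_triang_inv (q (t + x)) (q t)). lra. }
  apply Rle_lt_trans with
    ((Rabs (q t) + 1) * Rabs ((f (t + x) - 0) / x - l) +
     Rabs (q (t + x) - q t) * (Rabs l + 1)).
  - apply Rplus_le_compat.
    + apply Rmult_le_compat_r; [apply Rabs_pos|exact Q].
    + apply Rmult_le_compat_l; [apply Rabs_pos|lra].
  - apply Rlt_le_trans with
      ((Rabs (q t) + 1) * (eps / (2 * (Rabs (q t) + 1))) +
       eps / (2 * (Rabs l + 1)) * (Rabs l + 1)).
    + apply Rplus_lt_compat.
      * now apply Rmult_lt_compat_l.
      * now apply Rmult_lt_compat_r.
    + right. field. lra.
Qed.

(** The mean value theorem in the second variable gives
    [r u - r t = - (F u (r t) - c) / S u xi] with [xi] between [r u] and [r t].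
    The numerator is differentiable in [u] and vanishes at [t], and the factor
    [/ S u xi] is continuous there, which is what [is_derive_mult_vanishing]
    asks for. *)
Lemma implicit_is_derive (F S : R -> R -> R) (r : R -> R) (rho m c t l : R) :
  0 < m ->
  (forall u s, Rabs s < rho -> is_derive (F u) s (S u s)) ->
  (forall u s, Rabs s < rho -> m <= S u s) ->
  (forall u, Rabs (r u) < rho) ->
  (forall u, F u (r u) = c) ->
  is_derive (fun u => F u (r t)) t l ->
  continuous (fun w : R * R => S (fst w) (snd w)) (t, r t) ->
  is_derive r t (- l / S t (r t)).
Proof.
  intros Hm HF HS Hr Hc Hl HCS.
  assert (M : forall u, exists xi, Rabs xi < rho /\
            Rmin (r u) (r t) <= xi <= Rmax (r u) (r t) /\
            F u (r t) - c = S u xi * (r t - r u)).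
  { intros u.
    destruct (MVT_ball (F u) (S u) 0 rho (r u) (r t)) as [xi [H1 [H2 H3]]].
    - intros s Hs. apply HF. now rewrite Rminus_0_r in Hs.
    - now rewrite Rminus_0_r.
    - now rewrite Rminus_0_r.
    - exists xi. rewrite Rminus_0_r in H1. rewrite Hc in H3. auto. }
  set (xi := fun u => proj1_sig (constructive_indefinite_description _ (M u))).
  assert (Hxi : forall u, Rabs (xi u) < rho /\
            Rmin (r u) (r t) <= xi u <= Rmax (r u) (r t) /\
            F u (r t) - c = S u (xi u) * (r t - r u)).
  { intros u. exact (proj2_sig (constructive_indefinite_description _ (M u))). }
  set (f := fun u => F u (r t) - c).
  assert (f0 : f t = 0) by (unfold f; rewrite Hc; ring).
  assert (Hf : is_derive f t l).
  { unfold f. replace l with (l - 0) by ring.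
    apply (is_derive_minus (fun u => F u (r t)) (fun _ => c)); [exact Hl|].
    apply @is_derive_const. }
  assert (Sx : forall u, m <= S u (xi u)) by (intros u; apply HS, Hxi).
  assert (xit : xi t = r t).
  { destruct (Hxi t) as [_ [Hx _]]. revert Hx.
    unfold Rmin, Rmax; destruct (Rle_dec (r t) (r t)); lra. }
  assert (Cxi : continuous xi t).
  { apply filterlim_locally. intros e.
    assert (Cf : continuous f t) by (apply (@ex_derive_continuous R_AbsRing R_NormedModule); now exists l).
    generalize (continuous_close f t (m * e) Cf (Rmult_lt_0_compat _ _ Hm (cond_pos e))).
    apply filter_imp. intros u Hu. rewrite f0, Rminus_0_r in Hu.
    destruct (Hxi u) as [_ [Hx E]]. fold (f u) in E.
    change (Rabs (xi u - xi t) < e). rewrite xit.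
    assert (Hd : Rabs (r t - r u) < e).
    { apply (Rmult_lt_reg_l m); [exact Hm|]. eapply Rle_lt_trans; [|exact Hu].
      rewrite E, Rabs_mult. apply Rmult_le_compat_r; [apply Rabs_pos|].
      eapply Rle_trans; [apply (Sx u)|apply Rle_abs]. }
    eapply Rle_lt_trans; [|exact Hd]. revert Hx.
    unfold Rmin, Rmax; destruct (Rle_dec (r u) (r t)); intros Hx;
      unfold Rabs; destruct (Rcase_abs (xi u - r t)), (Rcase_abs (r t - r u)); lra. }
  assert (Cq : continuous (fun u => - / S u (xi u)) t).
  { apply (@continuous_opp R_UniformSpace R_AbsRing R_NormedModule (fun u => / S u (xi u))).
    apply (continuous_comp (fun u => S u (xi u)) Rinv).
    - apply (continuous_comp (fun u => (u, xi u)) (fun w => S (fst w) (snd w))).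
      + apply continuous_pair; [apply continuous_id|exact Cxi].
      + rewrite xit. exact HCS.
    - apply continuous_Rinv. generalize (Sx t). lra. }
  generalize (is_derive_mult_vanishing _ f t l f0 Hf Cq). rewrite xit.
  intros Hq.
  assert (Hq' : is_derive (fun u => r t + (- / S u (xi u)) * f u) t (0 + - / S t (r t) * l)).
  { apply (is_derive_plus (fun _ => r t) (fun u => (- / S u (xi u)) * f u)); [|exact Hq].
    apply @is_derive_const. }
  replace (- l / S t (r t)) with (0 + - / S t (r t) * l) by (unfold Rdiv; ring).
  apply (is_derive_ext (fun u => r t + (- / S u (xi u)) * f u)); [|exact Hq'].
  intros u. destruct (Hxi u) as [_ [_ E]]. fold (f u) in E. rewrite E.
  generalize (Sx u). intros. simpl. field. lra.
Qed.

(** Turns the pointwise expansion of the speed along a displaced cycle into the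
    expansion of its period. *)
Lemma RInt_first_order (lam f : R -> R) (T D eta : R) :
  0 < T -> (forall t, continuous lam t) -> (forall t, continuous f t) ->
  (forall t, Rabs (lam t - 1 - D * f t) <= eta) ->
  Rabs (RInt lam 0 T - T - D * RInt f 0 T) <= T * eta.
Proof.
  intros HT Cl Cf Hb.
  assert (El : ex_RInt lam 0 T).
  { apply (@ex_RInt_continuous R_CompleteNormedModule). intros; apply Cl. }
  assert (Ef : ex_RInt f 0 T).
  { apply (@ex_RInt_continuous R_CompleteNormedModule). intros; apply Cf. }
  assert (I : is_RInt (fun t => lam t - 1 - D * f t) 0 T
               (RInt lam 0 T - T - D * RInt f 0 T)).
  { apply (is_RInt_minus (fun t => lam t - 1) (fun t => D * f t)).
    - apply (is_RInt_minus lam (fun _ => 1)).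
      + now apply (@RInt_correct R_CompleteNormedModule).
      + generalize (is_RInt_const 0 T 1). unfold scal; simpl; unfold mult; simpl.
        now rewrite Rmult_1_r, Rminus_0_r.
    - apply (is_RInt_scal f). now apply (@RInt_correct R_CompleteNormedModule). }
  rewrite <- (is_RInt_unique _ _ _ _ I).
  replace (T * eta) with ((T - 0) * eta) by ring.
  apply abs_RInt_le_const; [lra|eexists; exact I|]. intros t _. apply Hb.
Qed.

(** * Connectedness and compactness of intervals *)

Lemma right_interval_induction (P : R -> Prop) (a b : R) :
  a <= b -> P a ->
  (forall x, a <= x <= b -> P x ->
     exists e, 0 < e /\ forall y, a <= y <= b -> Rabs (y - x) < e -> P y) ->
  (forall x, a <= x <= b ->
     (forall e, 0 < e -> exists y, a <= y <= b /\ Rabs (y - x) < e /\ P y) -> P x) ->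
  P b.
Proof.
  intros Hab Pa Ho Hc.
  (* The supremum of the points up to which [P] holds throughout is [b]. *)
  set (E := fun y => a <= y <= b /\ forall z, a <= z <= y -> P z).
  destruct (completeness E) as [m [Hub Hlub]].
  - exists b. intros y [Hy _]. apply Hy.
  - exists a. split; [lra|]. intros z Hz. now replace z with a by lra.
  - assert (Hm : a <= m <= b).
    { split.
      - apply Hub. split; [lra|]. intros z Hz. now replace z with a by lra.
      - apply Hlub. intros y [Hy _]. apply Hy. }
    assert (Hlt : forall z, a <= z < m -> P z).
    { intros z Hz. apply NNPP. intros Hn.
      assert (Hb : is_upper_bound E z).
      { intros y [Hy Hy']. destruct (Rle_or_lt y z); [assumption|].
        exfalso. apply Hn, Hy'. lra. }
      specialize (Hlub z Hb). lra. }
    assert (Pm : P m).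
    { apply Hc; [exact Hm|]. intros e He.
      destruct (Req_dec m a) as [->|Hne].
      - exists a. repeat split; try lra; [|exact Pa].
        rewrite Rminus_diag, Rabs_R0. exact He.
      - exists (Rmax a (m - e / 2)).
        assert (a <= Rmax a (m - e / 2) < m /\ m - e / 2 <= Rmax a (m - e / 2)).
        { unfold Rmax; destruct (Rle_dec a (m - e / 2)); lra. }
        repeat split; try lra.
        + apply Rabs_def1; lra.
        + apply Hlt; lra. }
    destruct (Rle_or_lt b m) as [Hbm|Hbm].
    { now replace b with m by lra. }
    destruct (Ho m Hm Pm) as [e [He Hy]].
    assert (HE : E (Rmin b (m + e / 2))).
    { assert (m < Rmin b (m + e / 2) <= b /\ Rmin b (m + e / 2) <= m + e / 2).
      { unfold Rmin; destruct (Rle_dec b (m + e / 2)); lra. }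
      split; [lra|]. intros z Hz.
      destruct (Rlt_or_le z m); [apply Hlt; lra|].
      apply Hy; [lra|]. apply Rabs_def1; lra. }
    specialize (Hub _ HE). exfalso. revert Hub.
    unfold Rmin; destruct (Rle_dec b (m + e / 2)); lra.
Qed.

(** Stated with a predicate that may fail outside the interval [I], so that it
    serves both for solutions on the line and for the levels common to two
    families of cycles. *)
Lemma interval_connected (I P : R -> Prop) (c : R) :
  (forall a b x, I a -> I b -> a <= x <= b -> I x) ->
  I c -> P c ->
  (forall x, I x -> P x ->
     exists e, 0 < e /\ forall y, I y -> Rabs (y - x) < e -> P y) ->
  (forall x, I x ->
     (forall e, 0 < e -> exists y, I y /\ Rabs (y - x) < e /\ P y) -> P x) ->
  forall x, I x -> P x.
Proof.
  intros HI Ic Pc Ho Hc x Ix.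
  destruct (Rle_or_lt c x) as [Hcx|Hxc].
  - apply (right_interval_induction (fun y => I y -> P y) c x); auto.
    + intros y Hy Py. assert (Iy : I y) by (apply (HI c x); auto).
      destruct (Ho y Iy (Py Iy)) as [e [He Hz]].
      exists e. split; [exact He|]. intros z _ Hzy Iz. now apply Hz.
    + intros y Hy Hz Iy. apply Hc; [exact Iy|]. intros e He.
      destruct (Hz e He) as [z [Hz1 [Hz2 Pz]]].
      assert (Iz : I z) by (apply (HI c x); auto). exists z. auto.
  (* The other direction follows by reflection. *)
  - replace x with (- - x) by ring.
    assert (G : I (- - x) -> P (- - x)); [|apply G; now rewrite Ropp_involutive].
    apply (right_interval_induction (fun y => I (- y) -> P (- y)) (- c) (- x)).
    + lra.
    + now rewrite Ropp_involutive.
    + intros y Hy Py. assert (Iy : I (- y)) by (apply (HI x c); auto; lra).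
      destruct (Ho _ Iy (Py Iy)) as [e [He Hz]].
      exists e. split; [exact He|]. intros z _ Hzy Iz. apply Hz; [exact Iz|].
      replace (- z - - y) with (- (z - y)) by ring. now rewrite Rabs_Ropp.
    + intros y Hy Hz Iy. apply Hc; [exact Iy|]. intros e He.
      destruct (Hz e He) as [z [Hz1 [Hz2 Pz]]].
      assert (Iz : I (- z)) by (apply (HI x c); auto; lra).
      exists (- z). repeat split; auto.
      replace (- z - - y) with (- (z - y)) by ring. now rewrite Rabs_Ropp.
Qed.

(** The form in which compactness is used: a local property with a margin [e],
    inherited by smaller margins, holds with one margin on the whole segment. *)
Lemma uniform_on_segment (P : R -> R -> Prop) (a b : R) :
  (forall t e e', P t e -> 0 < e' <= e -> P t e') ->
  (forall t, a <= t <= b ->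
     exists e, 0 < e /\ forall s, Rabs (s - t) < e -> P s e) ->
  exists e, 0 < e /\ forall t, a <= t <= b -> P t e.
Proof.
  intros Hmono Hloc.
  assert (Hd : forall t, exists e : posreal, a <= t <= b ->
             forall s, Rabs (s - t) < e -> P s e).
  { intros t. destruct (classic (a <= t <= b)) as [Ht|Ht].
    - destruct (Hloc t Ht) as [e [He Hs]]. now exists (mkposreal e He).
    - exists (mkposreal 1 Rlt_0_1). tauto. }
  set (delta := fun t => proj1_sig (constructive_indefinite_description _ (Hd t))).
  assert (Hdelta : forall t, a <= t <= b -> forall s, Rabs (s - t) < delta t -> P s (delta t)).
  { intros t. exact (proj2_sig (constructive_indefinite_description _ (Hd t))). }
  destruct (compactness_value_1d a b delta) as [d Hdd].
  exists d. split; [apply cond_pos|]. intros t Ht.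
  destruct (NNPP _ (Hdd t Ht)) as [s [Hs [Hts Hle]]].
  apply (Hmono t (delta s)); [now apply Hdelta|]. split; [apply cond_pos|exact Hle].
Qed.

(** * Uniqueness of solutions *)

(** Depending on the side of [t0], the product of [D] with a decreasing or an
    increasing exponential is monotone away from [t0], where it vanishes. *)
Lemma gronwall_zero (D dD : R -> R) (K t0 e : R) :
  (forall t, Rabs (t - t0) < e ->
     is_derive D t (dD t) /\ 0 <= D t /\ Rabs (dD t) <= K * D t) ->
  D t0 = 0 -> forall t, Rabs (t - t0) < e -> D t = 0.
Proof.
  intros HD D0 t Ht.
  assert (Ht0 : Rabs (t0 - t0) < e).
  { rewrite Rminus_diag, Rabs_R0. generalize (Rabs_pos (t - t0)). lra. }
  assert (M : forall k, exists s, Rabs (s - t0) < e /\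
     D t * exp (k * (t - t0)) =
       (dD s + k * D s) * (t - t0) * exp (k * (s - t0))).
  { intros k.
    destruct (MVT_ball (fun s => D s * exp (k * (s - t0)))
      (fun s => (dD s + k * D s) * exp (k * (s - t0))) t0 e t0 t) as [s [Hs [_ E]]];
      auto.
    - intros s Hs. destruct (HD s Hs) as [Hd _].
      auto_derive.
      + now exists (dD s).
      + rewrite (Derive_eta (fun x => D x) _ _ Hd). unfold Rminus. ring.
    - exists s. split; [exact Hs|]. rewrite D0 in E.
      replace (D t * exp (k * (t - t0))) with
        (D t * exp (k * (t - t0)) - 0 * exp (k * (t0 - t0))) by ring.
      rewrite E. ring. }
  assert (N : exists k, D t * exp (k * (t - t0)) <= 0).
  { destruct (Rle_or_lt t0 t) as [H|H].
    - exists (- K). destruct (M (- K)) as [s [Hs ->]].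
      destruct (HD s Hs) as [_ [_ Hb]]. apply Rabs_le_between in Hb.
      assert (0 < exp (- K * (s - t0))) by apply exp_pos.
      assert ((dD s + - K * D s) * (t - t0) <= 0) by nra. nra.
    - exists K. destruct (M K) as [s [Hs ->]].
      destruct (HD s Hs) as [_ [_ Hb]]. apply Rabs_le_between in Hb.
      assert (0 < exp (K * (s - t0))) by apply exp_pos.
      assert ((dD s + K * D s) * (t - t0) <= 0) by nra. nra. }
  destruct N as [k Hk]. destruct (HD t Ht) as [_ [Hp _]].
  assert (0 < exp (k * (t - t0))) by apply exp_pos. nra.
Qed.

(** The factor [lam] allows reparametrized solutions of [V]: a curve [c] with
    [c' = lam * V c] can be compared with a solution of [V] run at speed [lam]
    without inverting the change of time. *)
Lemma ode_unique (Om : R * R -> Prop) (V : R * R -> R * R) (lam : R -> R)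
    (u v : R -> R * R) :
  open Om -> is_Ck 1 Om (fun z => fst (V z)) -> is_Ck 1 Om (fun z => snd (V z)) ->
  (forall t, continuous lam t) ->
  (forall t, Om (u t) /\ is_derive u t (scal (lam t) (V (u t)))) ->
  (forall t, Om (v t) /\ is_derive v t (scal (lam t) (V (v t)))) ->
  u 0 = v 0 -> forall t, u t = v t.
Proof.
  intros HOm HV1 HV2 Hlam Hu Hv H0 t.
  assert (Cu : forall s, continuous u s).
  { intros s. exact (is_derive_continuous_pair _ _ _ (proj2 (Hu s))). }
  assert (Cv : forall s, continuous v s).
  { intros s. exact (is_derive_continuous_pair _ _ _ (proj2 (Hv s))). }
  apply (interval_connected (fun _ => True) (fun s => u s = v s) 0); auto.
  2: { intros s _ Hs. apply continuous_eq_limit; auto.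
       intros e He. destruct (Hs e He) as [r [_ Hr]]. now exists r. }
  clear t. intros t _ Ht.
  destruct (C1_locally_lipschitz Om _ (u t) HOm HV1 (proj1 (Hu t)))
    as [K1 [e1 [HK1 [He1 L1]]]].
  destruct (C1_locally_lipschitz Om _ (u t) HOm HV2 (proj1 (Hu t)))
    as [K2 [e2 [HK2 [He2 L2]]]].
  destruct (continuous_ball u t (Rmin e1 e2) (Cu t) ltac:(now apply Rmin_pos))
    as [d1 [Hd1 B1]].
  destruct (continuous_ball v t (Rmin e1 e2) (Cv t) ltac:(now apply Rmin_pos))
    as [d2 [Hd2 B2]].
  destruct (continuous_ball lam t 1 (Hlam t) Rlt_0_1) as [d3 [Hd3 B3]].
  set (d := Rmin d1 (Rmin d2 d3)).
  assert (Hd : 0 < d) by (unfold d; repeat apply Rmin_pos; auto).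
  assert (Hdd : d <= d1 /\ d <= d2 /\ d <= d3).
  { unfold d. repeat split.
    - apply Rmin_l.
    - eapply Rle_trans; [apply Rmin_r|apply Rmin_l].
    - eapply Rle_trans; [apply Rmin_r|apply Rmin_r]. }
  exists d. split; [exact Hd|]. intros s _ Hs.
  set (a := fun r => fst (u r) - fst (v r)).
  set (b := fun r => snd (u r) - snd (v r)).
  set (f := fun r => fst (V (u r)) - fst (V (v r))).
  set (g := fun r => snd (V (u r)) - snd (V (v r))).
  set (Lm := Rabs (lam t) + 1).
  (* Each field component moves by at most its Lipschitz constant times
     [|a| + |b|], and the product with [|a|] or [|b|] is at most twice
     [a * a + b * b]. *)
  assert (Z : a s * a s + b s * b s = 0).
  { apply (gronwall_zero (fun r => a r * a r + b r * b r)
             (fun r => 2 * lam r * (a r * f r + b r * g r))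
             (2 * Lm * ((K1 + K2) * 2)) t d); [|unfold a, b; rewrite Ht; ring|exact Hs].
    intros r Hr. split; [|split].
    - replace (2 * lam r * (a r * f r + b r * g r)) with
        (2 * (a r * (lam r * f r) + b r * (lam r * g r))) by ring.
      apply is_derive_sum_squares; unfold a, b, f, g; rewrite Rmult_minus_distr_l;
        apply @is_derive_minus;
        [ exact (is_derive_fst _ _ _ (proj2 (Hu r)))
        | exact (is_derive_fst _ _ _ (proj2 (Hv r)))
        | exact (is_derive_snd _ _ _ (proj2 (Hu r)))
        | exact (is_derive_snd _ _ _ (proj2 (Hv r))) ].
    - nra.
    - assert (Bu : ball (u t) (Rmin e1 e2) (u r)) by (apply B1; lra).
      assert (Bv : ball (u t) (Rmin e1 e2) (v r)) by (rewrite Ht; apply B2; lra).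
      assert (Hf : Rabs (f r) <= K1 * (Rabs (a r) + Rabs (b r))).
      { apply L1; eapply ball_le; try eassumption; apply Rmin_l. }
      assert (Hg : Rabs (g r) <= K2 * (Rabs (a r) + Rabs (b r))).
      { apply L2; eapply ball_le; try eassumption; apply Rmin_r. }
      assert (Hl : Rabs (lam r) <= Lm).
      { assert (Hl : Rabs (lam r - lam t) < 1) by (apply B3; lra).
        generalize (Rabs_triang_inv (lam r) (lam t)). unfold Lm. lra. }
      assert (S : Rabs (a r * f r + b r * g r) <=
                  (K1 + K2) * 2 * (a r * a r + b r * b r)).
      { eapply Rle_trans; [apply Rabs_triang|]. rewrite !Rabs_mult.
        generalize (Rabs_pos (a r)) (Rabs_pos (b r)) (Rsqr_abs (a r)) (Rsqr_abs (b r)).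
        unfold Rsqr. revert Hf Hg. generalize (Rabs (a r)) (Rabs (b r)).
        intros A B Hf Hg HA HB HA2 HB2.
        rewrite HA2, HB2.
        assert (A * Rabs (f r) <= A * (K1 * (A + B))) by (apply Rmult_le_compat_l; auto).
        assert (B * Rabs (g r) <= B * (K2 * (A + B))) by (apply Rmult_le_compat_l; auto).
        assert (HAB : 0 <= (A - B) * (A - B)) by exact (Rle_0_sqr (A - B)).
        assert (A * (A + B) <= 2 * (A * A + B * B)) by nra.
        assert (B * (A + B) <= 2 * (A * A + B * B)) by nra.
        nra. }
      rewrite !Rabs_mult, (Rabs_right 2) by lra.
      generalize (Rabs_pos (lam r)) (Rabs_pos (a r * f r + b r * g r)).
      intros. replace (2 * Lm * ((K1 + K2) * 2) * (a r * a r + b r * b r)) with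
        (2 * (Lm * ((K1 + K2) * 2 * (a r * a r + b r * b r)))) by ring.
      rewrite Rmult_assoc. apply Rmult_le_compat_l; [lra|].
      apply Rmult_le_compat; auto. }
  assert (a s = 0 /\ b s = 0) as [Ea Eb] by nra.
  unfold a, b in *. destruct (u s), (v s). simpl in *. f_equal; lra.
Qed.

Lemma is_derive_precomp_affine (g : R -> R * R) (t a : R) (l : R * R) :
  is_derive g (t + a) l -> is_derive (fun s => g (s + a)) t l.
Proof.
  intros Hg.
  replace l with (scal 1 l) by apply scal_one_pair.
  apply (is_derive_comp g (fun s => s + a) t l 1 Hg).
  auto_derive; auto.
Qed.

Lemma is_solution_shift (Om : R * R -> Prop) (V : R * R -> R * R)
    (g : R -> R * R) (a : R) :
  is_solution Om V g -> is_solution Om V (fun t => g (t + a)).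
Proof.
  intros Hg t. split; [apply Hg|].
  apply is_derive_precomp_affine, Hg.
Qed.

Definition C1_field (Om : R * R -> Prop) (V : R * R -> R * R) : Prop :=
  is_Ck 1 Om (fun z => fst (V z)) /\ is_Ck 1 Om (fun z => snd (V z)).

Lemma solution_meet (Om : R * R -> Prop) (V : R * R -> R * R)
    (g1 g2 : R -> R * R) (a b : R) :
  open Om -> C1_field Om V -> is_solution Om V g1 -> is_solution Om V g2 ->
  g1 a = g2 b -> forall t, g1 (t + a) = g2 (t + b).
Proof.
  intros HOm [HV1 HV2] H1 H2 E.
  apply (ode_unique Om V (fun _ => 1)); auto.
  - intros t. apply continuous_const.
  - intros t. rewrite (scal_one_pair (V (g1 (t + a)))).
    exact (is_solution_shift _ _ _ _ H1 t).
  - intros t. rewrite (scal_one_pair (V (g2 (t + b)))).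
    exact (is_solution_shift _ _ _ _ H2 t).
  - now rewrite !Rplus_0_l.
Qed.

(** * Periods *)

Lemma solution_return_periodic (Om : R * R -> Prop) (V : R * R -> R * R)
    (g : R -> R * R) (a b : R) :
  open Om -> C1_field Om V -> is_solution Om V g ->
  g a = g b -> periodic g (b - a).
Proof.
  intros HOm HV Hg E t.
  generalize (solution_meet Om V g g a b HOm HV Hg Hg E (t - a)).
  replace (t - a + a) with t by ring. replace (t - a + b) with (t + (b - a)) by ring.
  auto.
Qed.

Lemma periodic_opp (g : R -> R * R) (s : R) : periodic g s -> periodic g (- s).
Proof. intros H t. rewrite <- (H (t + - s)). f_equal. ring. Qed.

Lemma periodic_plus (g : R -> R * R) (s r : R) :
  periodic g s -> periodic g r -> periodic g (s + r).
Proof. intros Hs Hr t. rewrite <- Rplus_assoc, Hr. apply Hs. Qed.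

Lemma periodic_INR (g : R -> R * R) (s : R) (n : nat) :
  periodic g s -> periodic g (INR n * s).
Proof.
  intros Hs; induction n as [|n IH].
  - intros t. f_equal. simpl. ring.
  - rewrite S_INR. replace ((INR n + 1) * s) with (INR n * s + s) by ring.
    now apply periodic_plus.
Qed.

Lemma periodic_reduce (g : R -> R * R) (T : R) (t : R) :
  0 < T -> periodic g T -> exists s, 0 <= s <= T /\ g s = g t.
Proof.
  intros HT Hp.
  assert (N : forall u, 0 <= u -> exists s, 0 <= s <= T /\ exists n, u = s + INR n * T).
  { intros u Hu. destruct (nfloor_ex (u / T)) as [n [Hn1 Hn2]].
    - apply Rmult_le_pos; [exact Hu|]. left. now apply Rinv_0_lt_compat.
    - apply (Rmult_le_compat_r T) in Hn1; [|lra].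
      apply (Rmult_lt_compat_r T) in Hn2; [|lra].
      replace (u / T * T) with u in * by (field; lra).
      exists (u - INR n * T). split; [lra|]. exists n. ring. }
  destruct (Rle_or_lt 0 t) as [Ht|Ht].
  - destruct (N t Ht) as [s [Hs [n E]]]. exists s. split; [exact Hs|].
    rewrite E. symmetry. now apply periodic_INR.
  - destruct (N (- t)) as [s [Hs [n E]]]; [lra|].
    exists (T - s). split; [lra|].
    replace t with (T - s + - (INR (S n) * T)).
    + symmetry. now apply periodic_opp, periodic_INR.
    + rewrite S_INR. lra.
Qed.

Lemma is_derive_neq0_injective (f : R -> R) (t l : R) :
  is_derive f t l -> l <> 0 ->
  exists d, 0 < d /\ forall s, 0 < s < d -> f (t + s) <> f t.
Proof.
  intros Hf Hl. apply is_derive_Reals in Hf.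
  destruct (Hf (Rabs l) (Rabs_pos_lt l Hl)) as [d Hd].
  exists d. split; [apply cond_pos|]. intros s Hs E.
  specialize (Hd s ltac:(lra) ltac:(rewrite Rabs_right; lra)).
  rewrite E in Hd. replace ((f t - f t) / s - l) with (- l) in Hd by (field; lra).
  rewrite Rabs_Ropp in Hd. lra.
Qed.

(** Since the velocity at time 0 is not zero, [g] does not return to [g 0] before
    some time [d], so two distinct periods differ by at least [d] and the infimum
    of the periods is attained. *)
Lemma minimal_period_exists (g : R -> R * R) (v : R * R) :
  is_derive g 0 v -> v <> (0, 0) -> (exists s, 0 < s /\ periodic g s) ->
  exists T, minimal_period g T.
Proof.
  intros Hg Hv [s [Hs Ps]].
  assert (D : exists d, 0 < d /\ forall r, 0 < r < d -> g r <> g 0).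
  { destruct (Req_dec (fst v) 0) as [E1|E1].
    - destruct (Req_dec (snd v) 0) as [E2|E2].
      + exfalso. apply Hv. destruct v; simpl in *; now subst.
      + destruct (is_derive_neq0_injective _ _ _ (is_derive_snd _ _ _ Hg) E2)
          as [d [Hd Hd']].
        exists d. split; [exact Hd|]. intros r Hr E. apply (Hd' r Hr).
        now rewrite Rplus_0_l, E.
    - destruct (is_derive_neq0_injective _ _ _ (is_derive_fst _ _ _ Hg) E1)
        as [d [Hd Hd']].
      exists d. split; [exact Hd|]. intros r Hr E. apply (Hd' r Hr).
      now rewrite Rplus_0_l, E. }
  destruct D as [d [Hd Dd]].
  assert (Hd' : forall r, 0 < r -> periodic g r -> d <= r).
  { intros r Hr Pr. destruct (Rle_or_lt d r); [assumption|]. exfalso.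
    apply (Dd r); [lra|]. rewrite <- (Pr 0). f_equal. ring. }
  (* Opposites of periods, so that the supremum gives the infimum. *)
  set (E := fun x => 0 < - x /\ periodic g (- x)).
  destruct (completeness E) as [m [Hub Hlub]].
  - exists 0. intros x [Hx _]. lra.
  - exists (- s). split; rewrite Ropp_involutive; auto.
  - assert (Hmin : forall r, 0 < r -> periodic g r -> - m <= r).
    { intros r Hr Pr. assert (- r <= m); [|lra].
      apply Hub. split; rewrite Ropp_involutive; auto. }
    assert (Hap : forall e, 0 < e -> exists r, 0 < r < - m + e /\ periodic g r).
    { intros e He. apply NNPP. intros Hn.
      assert (Hb : is_upper_bound E (m - e)).
      { intros x [Hx Px]. destruct (Rle_or_lt x (m - e)); [assumption|].
        exfalso. apply Hn. exists (- x). split; [lra|exact Px]. }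
      specialize (Hlub _ Hb). lra. }
    destruct (Hap d Hd) as [T [HT PT]].
    exists T. split; [lra|split; [exact PT|]].
    intros r Hr Pr. destruct (Rle_or_lt T r) as [|Hrt]; [assumption|]. exfalso.
    assert (H1 : d <= T + - r).
    { apply Hd'; [lra|]. apply periodic_plus; [exact PT|now apply periodic_opp]. }
    generalize (Hmin r Hr Pr). lra.
Qed.

(** Used to show that a period is minimal: it is enough to exclude returns at times
    far from the two ends of the interval.  The witness is the largest multiple of
    [T] that does not exceed [P / 2]. *)
Lemma non_minimal_period_middle (g : R -> R * R) (T P : R) :
  minimal_period g T -> 0 < P -> periodic g P -> P <> T ->
  exists s, P / 4 < s <= P / 2 /\ periodic g s.
Proof.
  intros [HT [PT HTmin]] HP PP HPT.
  assert (T <= P) by auto.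
  assert (T <= P + - T).
  { apply HTmin; [lra|]. apply periodic_plus; [exact PP|now apply periodic_opp]. }
  destruct (nfloor_ex (P / 2 / T)) as [n [Hn1 Hn2]].
  { apply Rmult_le_pos; [lra|]. left. now apply Rinv_0_lt_compat. }
  apply (Rmult_le_compat_r T) in Hn1; [|lra].
  apply (Rmult_lt_compat_r T) in Hn2; [|lra].
  replace (P / 2 / T * T) with (P / 2) in * by (field; lra).
  exists (INR n * T). split; [|now apply periodic_INR].
  split; [|exact Hn1].
  destruct n as [|n].
  - simpl in *. lra.
  - assert (1 <= INR (S n)) by (rewrite S_INR; generalize (pos_INR n); lra). nra.
Qed.

Lemma minimal_period_unique (g : R -> R * R) (T P : R) :
  minimal_period g T -> minimal_period g P -> T = P.
Proof. intros [? [? HT]] [? [? HP]]. apply Rle_antisym; auto. Qed.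

Lemma minimal_period_shift (g1 g2 : R -> R * R) (a T : R) :
  (forall t, g2 t = g1 (t + a)) -> minimal_period g1 T -> minimal_period g2 T.
Proof.
  intros E [HT [PT Hmin]]. split; [exact HT|split].
  - intros t. rewrite !E, <- (PT (t + a)). f_equal. ring.
  - intros s Hs Ps. apply Hmin; [exact Hs|]. intros t.
    generalize (Ps (t - a)). rewrite !E.
    replace (t - a + s + a) with (t + s) by ring.
    now replace (t - a + a) with t by ring.
Qed.

Lemma uniform_on_cycle (g : R -> R * R) (T : R) (P : R * R -> R -> Prop) :
  (forall t, continuous g t) -> 0 < T -> periodic g T ->
  (forall z e e', P z e -> 0 < e' <= e -> P z e') ->
  (forall t, exists e, 0 < e /\ forall z, ball (g t) e z -> P z e) ->
  exists e, 0 < e /\ forall t, P (g t) e.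
Proof.
  intros Hg HT HP Hmono Hloc.
  destruct (uniform_on_segment (fun t e => P (g t) e) 0 T) as [e [He Pe]].
  - intros t. apply Hmono.
  - intros t _. destruct (Hloc t) as [e [He Pe]].
    destruct (continuous_ball g t e (Hg t) He) as [d [Hd Bd]].
    exists (Rmin e d). split; [now apply Rmin_pos|].
    intros s Hs. apply (Hmono _ e).
    + apply Pe, Bd. eapply Rlt_le_trans; [exact Hs|apply Rmin_r].
    + split; [now apply Rmin_pos|apply Rmin_l].
  - exists e. split; [exact He|]. intros t.
    destruct (periodic_reduce g T t HT HP) as [s [Hs <-]]. now apply Pe.
Qed.

(** The curve [c] runs along the cycle [g] at the speed [lam], so one turn of [c]
    takes the time [RInt lam 0 T] on [g].  If this were a proper multiple of the
    minimal period, [g] would return to its starting point at a time between a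
    quarter and a half of it, which the last hypothesis excludes. *)
Lemma reparametrized_cycle (Om : R * R -> Prop) (V : R * R -> R * R)
    (g c : R -> R * R) (lam : R -> R) (T T' : R) :
  open Om -> C1_field Om V -> is_solution Om V g -> minimal_period g T' ->
  (forall t, continuous lam t) -> (forall t, / 2 <= lam t <= 3 / 2) ->
  (forall t, Om (c t) /\ is_derive c t (scal (lam t) (V (c t)))) ->
  0 < T -> c T = c 0 -> g 0 = c 0 ->
  (forall t, T / 12 <= t <= 11 * T / 12 -> c t <> c 0) ->
  minimal_period g (RInt lam 0 T) /\
  (forall t, g (RInt lam 0 t) = c t) /\
  (forall s, exists t, g s = c t).
Proof.
  intros HOm HV Hg HT' Clam Blam Hc HT PT H0 Hsep.
  set (tau := fun t => RInt lam 0 t).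
  assert (Dtau : forall t, is_derive tau t (lam t)).
  { intros t. apply (is_derive_RInt lam tau 0 t); [|apply Clam].
    apply filter_forall. intros s. apply (@RInt_correct R_CompleteNormedModule).
    apply (@ex_RInt_continuous R_CompleteNormedModule). intros; apply Clam. }
  assert (tau0 : tau 0 = 0) by apply (@RInt_point R_CompleteNormedModule).
  assert (Binc : forall a b, a <= b -> (b - a) / 2 <= tau b - tau a <= 3 / 2 * (b - a)).
  { intros a b Hab.
    destruct (MVT_gen tau a b lam) as [x [_ E]].
    - intros s _. apply Dtau.
    - intros s _. apply continuity_pt_filterlim.
      apply (@ex_derive_continuous R_AbsRing R_NormedModule). eexists. apply Dtau.
    - rewrite E. generalize (Blam x). nra. }
  assert (Follow : forall t, g (tau t) = c t).
  { apply (ode_unique Om V lam (fun t => g (tau t)) c HOm (proj1 HV) (proj2 HV) Clam).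
    - intros t. split; [apply Hg|].
      apply (is_derive_comp g tau t (V (g (tau t))) (lam t)); [apply Hg|apply Dtau].
    - exact Hc.
    - now rewrite tau0. }
  assert (Htau : forall s, 0 <= s <= tau T -> exists t, 0 <= t <= T /\ tau t = s).
  { intros s Hs.
    assert (Ct : continuity tau).
    { intros x. apply continuity_pt_filterlim.
      apply (@ex_derive_continuous R_AbsRing R_NormedModule). eexists. apply Dtau. }
    destruct (IVT_gen tau 0 T s Ct) as [t [Ht E]].
    - rewrite tau0, Rmin_left, Rmax_right; lra.
    - rewrite Rmin_left, Rmax_right in Ht by lra. exists t. auto. }
  assert (HP : T / 2 <= tau T <= 3 / 2 * T) by (generalize (Binc 0 T); lra).
  assert (PP : periodic g (tau T)).
  { replace (tau T) with (tau T - 0) by ring.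
    apply (solution_return_periodic Om V g 0 (tau T) HOm HV Hg).
    now rewrite Follow, PT. }
  split; [|split; [exact Follow|]].
  - destruct (Req_dec (tau T) T') as [E|E].
    { fold (tau T). now rewrite E. }
    exfalso.
    destruct (non_minimal_period_middle g T' (tau T) HT') as [s [Hs Ps]]; auto; [lra|].
    destruct (Htau s) as [t [Ht Et]]; [lra|].
    apply (Hsep t).
    + generalize (Binc 0 t (proj1 Ht)) (Binc t T (proj2 Ht)). lra.
    + rewrite <- Follow, Et, <- H0, <- (Ps 0). f_equal. ring.
  - intros s. destruct (periodic_reduce g (tau T) s) as [u [Hu <-]]; auto; [lra|].
    destruct (Htau u Hu) as [t [_ <-]]. exists t. apply Follow.
Qed.

(** * Moving a point along the gradient *)

(** The line through [z] directed by the gradient of [H] at [z]. *)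
Definition push (H : R * R -> R) (z : R * R) (r : R) : R * R :=
  (fst z + r * dx H z, snd z + r * dy H z).

(** The derivative of [H] along [push H z].  With [n] the gradient at [z], it is
    also the wedge product of [V_H H] at [push H z r] with [n]. *)
Definition slope (H : R * R -> R) (z : R * R) (r : R) : R :=
  dx H (push H z r) * dx H z + dy H (push H z r) * dy H z.

(** The derivative of [slope H z]. *)
Definition curv (H : R * R -> R) (z : R * R) (r : R) : R :=
  (dx (dx H) (push H z r) * dx H z + dy (dx H) (push H z r) * dy H z) * dx H z +
  (dx (dy H) (push H z r) * dx H z + dy (dy H) (push H z r) * dy H z) * dy H z.

(** Let [n] be the gradient of [H] along a solution of the Hamiltonian system; this
    is the wedge product of its time derivative with [n]. *)
Definition twist (H : R * R -> R) (z : R * R) : R :=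
  (dx (dx H) z * dy H z + dy (dx H) z * - dx H z) * dy H z -
  (dx (dy H) z * dy H z + dy (dy H) z * - dx H z) * dx H z.

(** The value of [mu_H] in the form in which it appears when a cycle is displaced;
    see [bracket_and_divergence]. *)
Definition dilation (H : R * R -> R) (z : R * R) : R :=
  (twist H z - curv H z 0) / (slope H z 0 * slope H z 0).

Lemma push_0 (H : R * R -> R) (z : R * R) : push H z 0 = z.
Proof. unfold push. rewrite !Rmult_0_l, !Rplus_0_r. now destruct z. Qed.

Lemma slope_0 (H : R * R -> R) (z : R * R) :
  slope H z 0 = dx H z * dx H z + dy H z * dy H z.
Proof. unfold slope. now rewrite push_0. Qed.

Section Hamiltonian_system.

Variables (Om : R * R -> Prop) (H : R * R -> R).
Hypothesis Om_open : open Om.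
Hypothesis H_C2 : is_Ck 2 Om H.

Lemma H_C1 : is_Ck 1 Om H.
Proof. exact (is_Ck_pred 1 Om H H_C2). Qed.

Lemma dxH_C1 : is_Ck 1 Om (dx H).
Proof. exact (proj1 (proj2 (proj2 H_C2))). Qed.

Lemma dyH_C1 : is_Ck 1 Om (dy H).
Proof. exact (proj2 (proj2 (proj2 H_C2))). Qed.

Lemma H_partials_C0 :
  (is_Ck 0 Om (dx H) /\ is_Ck 0 Om (dy H)) /\
  (is_Ck 0 Om (dx (dx H)) /\ is_Ck 0 Om (dy (dx H))) /\
  (is_Ck 0 Om (dx (dy H)) /\ is_Ck 0 Om (dy (dy H))).
Proof.
  split; [split; apply is_Ck_pred; [exact dxH_C1|exact dyH_C1]|].
  split; [exact (proj2 (proj2 dxH_C1))|exact (proj2 (proj2 dyH_C1))].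
Qed.

Lemma continuous_push {U : UniformSpace} (zf : U -> R * R) (rf : U -> R) (w : U) :
  continuous zf w -> continuous rf w -> Om (zf w) ->
  continuous (fun u => push H (zf u) (rf u)) w.
Proof.
  intros Hz Hr HOm. unfold push.
  apply continuous_pair; apply continuous_Rplus.
  - apply (continuous_comp zf fst); [exact Hz|apply continuous_proj1].
  - apply continuous_Rmult; [exact Hr|].
    apply (continuous_comp zf (dx H)); [exact Hz|]. exact (proj1 dxH_C1 _ HOm).
  - apply (continuous_comp zf snd); [exact Hz|apply continuous_proj2].
  - apply continuous_Rmult; [exact Hr|].
    apply (continuous_comp zf (dy H)); [exact Hz|]. exact (proj1 dyH_C1 _ HOm).
Qed.

Lemma continuous_at_push {U : UniformSpace} (f : R * R -> R)
    (zf : U -> R * R) (rf : U -> R) (w : U) :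
  continuous zf w -> continuous rf w -> Om (zf w) -> Om (push H (zf w) (rf w)) ->
  is_Ck 0 Om f -> continuous (fun u => f (push H (zf u) (rf u))) w.
Proof.
  intros Hz Hr H1 H2 [Hf _].
  apply (continuous_comp (fun u => push H (zf u) (rf u)) f).
  - exact (continuous_push zf rf w Hz Hr H1).
  - exact (Hf _ H2).
Qed.

Lemma continuous_at_base {U : UniformSpace} (f : R * R -> R) (zf : U -> R * R) (w : U) :
  continuous zf w -> Om (zf w) -> is_Ck 0 Om f -> continuous (fun u => f (zf u)) w.
Proof.
  intros Hz H1 [Hf _]. apply (continuous_comp zf f); [exact Hz|exact (Hf _ H1)].
Qed.

Lemma continuous_slope {U : UniformSpace} (zf : U -> R * R) (rf : U -> R) (w : U) :
  continuous zf w -> continuous rf w -> Om (zf w) -> Om (push H (zf w) (rf w)) ->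
  continuous (fun u => slope H (zf u) (rf u)) w.
Proof.
  intros Hz Hr H1 H2.
  destruct H_partials_C0 as [[X Y] _].
  pose (P := fun f Hf => continuous_at_push f zf rf w Hz Hr H1 H2 Hf).
  pose (B := fun f Hf => continuous_at_base f zf w Hz H1 Hf).
  exact (continuous_Rplus _ _ _ (continuous_Rmult _ _ _ (P _ X) (B _ X))
           (continuous_Rmult _ _ _ (P _ Y) (B _ Y))).
Qed.

Lemma continuous_curv {U : UniformSpace} (zf : U -> R * R) (rf : U -> R) (w : U) :
  continuous zf w -> continuous rf w -> Om (zf w) -> Om (push H (zf w) (rf w)) ->
  continuous (fun u => curv H (zf u) (rf u)) w.
Proof.
  intros Hz Hr H1 H2.
  destruct H_partials_C0 as [[X Y] [[XX YX] [XY YY]]].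
  pose (P := fun f Hf => continuous_at_push f zf rf w Hz Hr H1 H2 Hf).
  pose (B := fun f Hf => continuous_at_base f zf w Hz H1 Hf).
  assert (C : forall f g, is_Ck 0 Om f -> is_Ck 0 Om g -> continuous (fun u =>
    f (push H (zf u) (rf u)) * dx H (zf u) + g (push H (zf u) (rf u)) * dy H (zf u)) w).
  { intros f g Hf Hg.
    exact (continuous_Rplus _ _ _ (continuous_Rmult _ _ _ (P _ Hf) (B _ X))
             (continuous_Rmult _ _ _ (P _ Hg) (B _ Y))). }
  exact (continuous_Rplus _ _ _ (continuous_Rmult _ _ _ (C _ _ XX YX) (B _ X))
           (continuous_Rmult _ _ _ (C _ _ XY YY) (B _ Y))).
Qed.

Lemma continuous_twist {U : UniformSpace} (zf : U -> R * R) (w : U) :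
  continuous zf w -> Om (zf w) -> continuous (fun u => twist H (zf u)) w.
Proof.
  intros Hz H1.
  destruct H_partials_C0 as [[X Y] [[XX YX] [XY YY]]].
  pose (B := fun f Hf => continuous_at_base f zf w Hz H1 Hf).
  assert (C : forall f g, is_Ck 0 Om f -> is_Ck 0 Om g -> continuous (fun u =>
    f (zf u) * dy H (zf u) + g (zf u) * - dx H (zf u)) w).
  { intros f g Hf Hg.
    exact (continuous_Rplus _ _ _ (continuous_Rmult _ _ _ (B _ Hf) (B _ Y))
             (continuous_Rmult _ _ _ (B _ Hg)
                (@continuous_opp U R_AbsRing R_NormedModule _ _ (B _ X)))). }
  exact (continuous_Rminus _ _ _ (continuous_Rmult _ _ _ (C _ _ XX YX) (B _ Y))
           (continuous_Rmult _ _ _ (C _ _ XY YY) (B _ X))).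
Qed.

Lemma continuous_dilation {U : UniformSpace} (zf : U -> R * R) (w : U) :
  continuous zf w -> Om (zf w) -> slope H (zf w) 0 <> 0 ->
  continuous (fun u => dilation H (zf u)) w.
Proof.
  intros Hz H1 Hs. unfold dilation.
  assert (H2 : Om (push H (zf w) 0)) by now rewrite push_0.
  assert (C0 : continuous (fun _ : U => 0) w) by apply continuous_const.
  assert (S : continuous (fun u => slope H (zf u) 0) w)
    by exact (continuous_slope zf (fun _ => 0) w Hz C0 H1 H2).
  exact (continuous_Rdiv _ _ _
    (continuous_Rminus _ _ _ (continuous_twist zf w Hz H1)
       (continuous_curv zf (fun _ => 0) w Hz C0 H1 H2))
    (continuous_Rmult _ _ _ S S) (Rmult_integral_contrapositive _ _ (conj Hs Hs))).
Qed.

(** The three parameters are independent because [r1] and [r2] will be intermediate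
    points given by the mean value theorem and [r3] a displacement.  At
    [r1 = r2 = r3 = 0] the difference vanishes identically, so continuity makes it
    small. *)
Lemma local_estimates (O : R * R -> Prop) (z0 : R * R) (eta : R) :
  open O -> O z0 -> Om z0 -> 0 < slope H z0 0 -> 0 < eta ->
  exists rho, 0 < rho /\ forall z, ball z0 rho z ->
    Rabs (dilation H z) <= / rho /\
    forall r1 r2 r3, Rabs r1 <= rho -> Rabs r2 <= rho -> Rabs r3 <= rho ->
      O (push H z r1) /\ rho <= slope H z r1 /\
      Rabs ((twist H z - curv H z r1) / (slope H z r2 * slope H z r3)
            - dilation H z) <= eta.
Proof.
  intros HO HOz HOm Hs Heta.
  set (w0 := (z0, (0, (0, 0))) : (R * R) * (R * (R * R))).
  set (zf := fun w : (R * R) * (R * (R * R)) => fst w).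
  set (f1 := fun w : (R * R) * (R * (R * R)) => fst (snd w)).
  set (f2 := fun w : (R * R) * (R * (R * R)) => fst (snd (snd w))).
  set (f3 := fun w : (R * R) * (R * (R * R)) => snd (snd (snd w))).
  assert (Cz : continuous zf w0) by apply continuous_proj1.
  assert (C1 : continuous f1 w0).
  { apply (continuous_comp snd fst); [apply continuous_proj2|apply continuous_proj1]. }
  assert (C23 : continuous (fun w => snd (snd w)) w0).
  { apply (continuous_comp snd snd); apply continuous_proj2. }
  assert (C2 : continuous f2 w0).
  { apply (continuous_comp (fun w => snd (snd w)) fst); [exact C23|apply continuous_proj1]. }
  assert (C3 : continuous f3 w0).
  { apply (continuous_comp (fun w => snd (snd w)) snd); [exact C23|apply continuous_proj2]. }
  assert (Op : Om (push H z0 0)) by now rewrite push_0.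
  assert (L : locally w0 (fun w =>
     O (push H (zf w) (f1 w)) /\
     Rabs (slope H (zf w) (f1 w) - slope H z0 0) < slope H z0 0 / 2 /\
     Rabs (dilation H (zf w) - dilation H z0) < 1 /\
     Rabs ((twist H (zf w) - curv H (zf w) (f1 w)) /
             (slope H (zf w) (f2 w) * slope H (zf w) (f3 w))
            - dilation H (zf w) - 0) < eta)).
  { apply filter_and; [|apply filter_and; [|apply filter_and]].
    - apply (continuous_push zf f1 w0 Cz C1 HOm). apply HO.
      change (O (push H z0 0)). now rewrite push_0.
    - apply (continuous_close (fun w => slope H (zf w) (f1 w)) w0); [|lra].
      exact (continuous_slope zf f1 w0 Cz C1 HOm Op).
    - apply (continuous_close (fun w => dilation H (zf w)) w0); [|lra].
      apply (continuous_dilation zf w0 Cz HOm). change (slope H z0 0 <> 0). lra.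
    - set (Q := fun w => (twist H (zf w) - curv H (zf w) (f1 w)) /
             (slope H (zf w) (f2 w) * slope H (zf w) (f3 w)) - dilation H (zf w)).
      replace 0 with (Q w0).
      + apply (continuous_close Q); [|exact Heta].
        assert (Hs' : slope H z0 0 <> 0) by lra.
        exact (continuous_Rminus _ _ _ (continuous_Rdiv _ _ _
          (continuous_Rminus _ _ _ (continuous_twist zf w0 Cz HOm)
             (continuous_curv zf f1 w0 Cz C1 HOm Op))
          (continuous_Rmult _ _ _ (continuous_slope zf f2 w0 Cz C2 HOm Op)
             (continuous_slope zf f3 w0 Cz C3 HOm Op))
          (Rmult_integral_contrapositive _ _ (conj Hs' Hs')))
          (continuous_dilation zf w0 Cz HOm Hs')).
      + unfold Q, dilation. apply Rminus_diag. }
  destruct L as [e He].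
  set (rho := Rmin (e / 2) (Rmin (slope H z0 0 / 2) (/ (Rabs (dilation H z0) + 1)))).
  assert (Hinv : 0 < / (Rabs (dilation H z0) + 1)).
  { apply Rinv_0_lt_compat. generalize (Rabs_pos (dilation H z0)). lra. }
  assert (Hr : 0 < rho).
  { unfold rho. generalize (cond_pos e). intros. repeat apply Rmin_pos; lra. }
  assert (Hr1 : rho < e).
  { generalize (cond_pos e) (Rmin_l (e / 2) (Rmin (slope H z0 0 / 2) (/ (Rabs (dilation H z0) + 1)))).
    fold rho. lra. }
  assert (Hr2 : rho <= slope H z0 0 / 2).
  { unfold rho. eapply Rle_trans; [apply Rmin_r|apply Rmin_l]. }
  assert (Hr3 : rho <= / (Rabs (dilation H z0) + 1)).
  { unfold rho. eapply Rle_trans; [apply Rmin_r|apply Rmin_r]. }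
  assert (B : forall z r1 r2 r3, ball z0 rho z -> Rabs r1 <= rho -> Rabs r2 <= rho ->
            Rabs r3 <= rho -> ball w0 e (z, (r1, (r2, r3)))).
  { intros z r1 r2 r3 Hz H1 H2 H3. repeat split.
    - eapply Rlt_trans; [apply Hz|exact Hr1].
    - eapply Rlt_trans; [apply Hz|exact Hr1].
    - change (Rabs (r1 - 0) < e). rewrite Rminus_0_r. lra.
    - change (Rabs (r2 - 0) < e). rewrite Rminus_0_r. lra.
    - change (Rabs (r3 - 0) < e). rewrite Rminus_0_r. lra. }
  exists rho. split; [exact Hr|]. intros z Hz. split.
  - assert (R0 : Rabs 0 <= rho) by (rewrite Rabs_R0; lra).
    destruct (He _ (B z 0 0 0 Hz R0 R0 R0)) as [_ [_ [Hd _]]]. unfold zf in Hd; simpl in Hd.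
    apply Rle_trans with (Rabs (dilation H z0) + 1).
    + generalize (Rabs_triang_inv (dilation H z) (dilation H z0)). lra.
    + rewrite <- (Rinv_inv (Rabs (dilation H z0) + 1)).
      now apply Rinv_le_contravar.
  - intros r1 r2 r3 H1 H2 H3.
    destruct (He _ (B z r1 r2 r3 Hz H1 H2 H3)) as [A1 [A2 [_ A3]]].
    unfold zf, f1, f2, f3 in *; simpl in *. split; [exact A1|split].
    + apply Rabs_def2 in A2. lra.
    + rewrite Rminus_0_r in A3. now left.
Qed.

Lemma is_derive_along (f : R * R -> R) (g : R -> R * R) (t : R) :
  is_Ck 1 Om f -> is_solution Om (V_H H) g ->
  is_derive (fun s => f (g s)) t
    (dx f (g t) * dy H (g t) + dy f (g t) * - dx H (g t)).
Proof.
  intros Hf Hg. destruct (Hg t) as [HO Hd].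
  assert (HO' : Om (fst (g t), snd (g t))) by now rewrite <- surjective_pairing.
  generalize (C1_is_derive_curve Om f (fun s => fst (g s)) (fun s => snd (g s)) t _ _
    Om_open Hf HO' (is_derive_fst _ _ _ Hd) (is_derive_snd _ _ _ Hd)).
  rewrite <- (surjective_pairing (g t)). apply is_derive_ext.
  intros s. now rewrite <- surjective_pairing.
Qed.

Lemma is_derive_push (f : R * R -> R) (z : R * R) (r : R) :
  is_Ck 1 Om f -> Om (push H z r) ->
  is_derive (fun s => f (push H z s)) r
    (dx f (push H z r) * dx H z + dy f (push H z r) * dy H z).
Proof.
  intros Hf Hr.
  apply (C1_is_derive_curve Om f (fun s => fst z + s * dx H z)
           (fun s => snd z + s * dy H z)); auto; auto_derive; auto; ring.
Qed.

Lemma is_derive_slope (z : R * R) (r : R) :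
  Om (push H z r) -> is_derive (slope H z) r (curv H z r).
Proof.
  intros Hr.
  generalize (is_derive_push _ z r dxH_C1 Hr)
    (is_derive_push _ z r dyH_C1 Hr). intros Dx Dy.
  apply (is_derive_plus (fun s => dx H (push H z s) * dx H z)
           (fun s => dy H (push H z s) * dy H z)).
  - replace (dx H z) with (1 * dx H z) at 2 by ring.
    generalize (is_derive_scal_l _ _ _ (dx H z) Dx).
    unfold scal; simpl; unfold mult; simpl. now rewrite Rmult_1_l.
  - generalize (is_derive_scal_l _ _ _ (dy H z) Dy).
    unfold scal; simpl; unfold mult; simpl. auto.
Qed.

Section Normal_segment.

Variables (z : R * R) (rho : R).
Hypothesis rho_pos : 0 < rho.
Hypothesis push_dom : forall r, Rabs r <= rho -> Om (push H z r).
Hypothesis slope_bound : forall r, Rabs r <= rho -> rho <= slope H z r.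

Lemma level_increment (a b : R) :
  Rabs a <= rho -> Rabs b <= rho ->
  exists xi, Rabs xi <= rho /\
    H (push H z b) - H (push H z a) = slope H z xi * (b - a).
Proof.
  intros Ha Hb. apply Rabs_le_between in Ha; apply Rabs_le_between in Hb.
  assert (Hin : forall s, Rmin a b <= s <= Rmax a b -> Rabs s <= rho).
  { intros s. unfold Rmin, Rmax; destruct (Rle_dec a b); intros; apply Rabs_le; lra. }
  assert (D : forall s, Rabs s <= rho ->
            is_derive (fun s => H (push H z s)) s (slope H z s)).
  { intros s Hs. apply (is_derive_push H z s H_C1). now apply push_dom. }
  destruct (MVT_gen (fun s => H (push H z s)) a b (slope H z)) as [xi [Hx E]].
  - intros s Hs. apply D, Hin. lra.
  - intros s Hs. apply continuity_pt_filterlim.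
    apply (@ex_derive_continuous R_AbsRing R_NormedModule (fun s => H (push H z s))).
    eexists. apply D, Hin, Hs.
  - exists xi. auto.
Qed.

Lemma slope_increment (b : R) :
  Rabs b <= rho ->
  exists xi, Rabs xi <= rho /\
    slope H z b - slope H z 0 = curv H z xi * b.
Proof.
  intros Hb. apply Rabs_le_between in Hb.
  assert (Hin : forall s, Rmin 0 b <= s <= Rmax 0 b -> Rabs s <= rho).
  { intros s. unfold Rmin, Rmax; destruct (Rle_dec 0 b); intros; apply Rabs_le; lra. }
  destruct (MVT_gen (slope H z) 0 b (curv H z)) as [xi [Hx E]].
  - intros s Hs. apply is_derive_slope, push_dom, Hin. lra.
  - intros s Hs. apply continuity_pt_filterlim.
    apply (@ex_derive_continuous R_AbsRing R_NormedModule (slope H z)).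
    eexists. apply is_derive_slope, push_dom, Hin, Hs.
  - exists xi. split; [auto|]. now rewrite E, Rminus_0_r.
Qed.

(** Moving by [r] along the gradient changes the level by at least [rho * |r|], so
    a small change of level needs a small displacement only. *)
Lemma displacement_bound (r : R) :
  Rabs r <= rho -> rho * Rabs r <= Rabs (H (push H z r) - H z).
Proof.
  intros Hr.
  destruct (level_increment 0 r) as [xi [Hx E]]; [rewrite Rabs_R0; lra|exact Hr|].
  rewrite push_0, Rminus_0_r in E. rewrite E, Rabs_mult.
  apply Rmult_le_compat_r; [apply Rabs_pos|].
  eapply Rle_trans; [now apply (slope_bound xi)|apply Rle_abs].
Qed.

Lemma displacement_unique (a b : R) :
  Rabs a <= rho -> Rabs b <= rho ->
  H (push H z a) = H (push H z b) -> a = b.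
Proof.
  intros Ha Hb E. destruct (level_increment a b Ha Hb) as [xi [Hx E']].
  rewrite E, Rminus_diag in E'. generalize (slope_bound xi Hx). intros.
  symmetry in E'. apply Rmult_integral in E'. lra.
Qed.

Lemma displacement_exists (h' : R) :
  Rabs (h' - H z) < rho * rho -> exists r, Rabs r < rho /\ H (push H z r) = h'.
Proof.
  intros Hh. apply Rabs_def2 in Hh.
  assert (Rr : Rabs rho <= rho) by (rewrite Rabs_right; lra).
  assert (Rr' : Rabs (- rho) <= rho) by (rewrite Rabs_Ropp; exact Rr).
  assert (R0 : Rabs 0 <= rho) by (rewrite Rabs_R0; lra).
  destruct (level_increment 0 rho R0 Rr) as [x1 [Hx1 E1]].
  destruct (level_increment 0 (- rho) R0 Rr') as [x2 [Hx2 E2]].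
  rewrite push_0 in E1, E2.
  generalize (slope_bound x1 Hx1) (slope_bound x2 Hx2). intros S1 S2.
  assert (L1 : h' < H (push H z rho)) by nra.
  assert (L2 : H (push H z (- rho)) < h') by nra.
  destruct (IVT_interv (fun s => H (push H z s) - h') (- rho) rho)
    as [r [Hr Er]]; try lra.
  - intros s Hs. apply continuity_pt_filterlim.
    apply (@ex_derive_continuous R_AbsRing R_NormedModule (fun s => H (push H z s) - h')).
    eexists. apply (is_derive_minus (fun s => H (push H z s)) (fun _ => h')).
    + apply (is_derive_push H z s H_C1), push_dom. apply Rabs_le. lra.
    + apply @is_derive_const.
  - exists r. split; [|lra].
    assert (r <> rho) by (intros ->; lra). assert (r <> - rho) by (intros ->; lra).
    apply Rabs_def1; lra.
Qed.

End Normal_segment.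

(** * Displacing a cycle to a nearby level *)

Section Displaced_cycle.

Variables (g : R -> R * R) (h rho eta : R).
Hypothesis g_sol : is_solution Om (V_H H) g.
Hypothesis g_level : forall t, H (g t) = h.
Hypothesis rho_pos : 0 < rho.
Hypothesis push_dom : forall t r, Rabs r <= rho -> Om (push H (g t) r).
Hypothesis slope_bound : forall t r, Rabs r <= rho -> rho <= slope H (g t) r.
Hypothesis dilation_close : forall t r1 r2 r3,
  Rabs r1 <= rho -> Rabs r2 <= rho -> Rabs r3 <= rho ->
  Rabs ((twist H (g t) - curv H (g t) r1) / (slope H (g t) r2 * slope H (g t) r3)
            - dilation H (g t)) <= eta.

(** The displacement [r] is given by the implicit function theorem.  The curve
    stays on a level set, so its derivative is [lam] times the Hamiltonian field.
    The wedge product with [n], the gradient at [g t], determines [lam]: the term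
    in the derivative of [r] is parallel to [n] and disappears, which leaves
    [lam = (slope 0 + r * twist) / slope r].  The mean value theorem for [slope]
    and for [H] along the normal then gives
    [lam - 1 = (h' - h) * (twist - curv x2) / (slope x1 * slope r)] with
    intermediate points [x1] and [x2]. *)
Lemma displaced_cycle (h' : R) :
  Rabs (h' - h) < rho * rho ->
  exists r lam : R -> R,
    (forall t, Rabs (r t) < rho /\ H (push H (g t) (r t)) = h') /\
    (forall t, continuous lam t) /\
    (forall t, is_derive (fun s => push H (g s) (r s)) t
                 (scal (lam t) (V_H H (push H (g t) (r t))))) /\
    (forall t, Rabs (lam t - 1 - (h' - h) * dilation H (g t)) <= eta * Rabs (h' - h)).
Proof.
  intros Hh.
  assert (displ : forall t, exists r, Rabs r < rho /\ H (push H (g t) r) = h').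
  { intros t. apply (displacement_exists (g t) rho rho_pos (push_dom t) (slope_bound t)).
    now rewrite g_level. }
  set (r := fun t => proj1_sig (constructive_indefinite_description _
                       (displ t))).
  assert (Hr : forall t, Rabs (r t) < rho /\ H (push H (g t) (r t)) = h').
  { intros t. exact (proj2_sig (constructive_indefinite_description _
                       (displ t))). }
  clearbody r.
  assert (Hr' : forall t, Rabs (r t) <= rho) by (intros t; left; apply Hr).
  assert (Cg : forall t, continuous g t).
  { intros t. exact (is_derive_continuous_pair _ _ _ (proj2 (g_sol t))). }
  assert (Dg1 : forall t, is_derive (fun s => fst (g s)) t (dy H (g t))).
  { intros t. exact (is_derive_fst _ _ _ (proj2 (g_sol t))). }
  assert (Dg2 : forall t, is_derive (fun s => snd (g s)) t (- dx H (g t))).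
  { intros t. exact (is_derive_snd _ _ _ (proj2 (g_sol t))). }
  set (n1' := fun t => dx (dx H) (g t) * dy H (g t) + dy (dx H) (g t) * - dx H (g t)).
  set (n2' := fun t => dx (dy H) (g t) * dy H (g t) + dy (dy H) (g t) * - dx H (g t)).
  assert (Dn1 : forall t, is_derive (fun s => dx H (g s)) t (n1' t)).
  { intros t. exact (is_derive_along _ g t dxH_C1 g_sol). }
  assert (Dn2 : forall t, is_derive (fun s => dy H (g s)) t (n2' t)).
  { intros t. exact (is_derive_along _ g t dyH_C1 g_sol). }
  assert (Dr : exists r', forall t, is_derive r t (r' t)).
  { exists (fun t => - (dx H (push H (g t) (r t)) * (dy H (g t) + r t * n1' t) +
                 dy H (push H (g t) (r t)) * (- dx H (g t) + r t * n2' t))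
               / slope H (g t) (r t)).
    intros t.
    apply (implicit_is_derive (fun u s => H (push H (g u) s)) (fun u s => slope H (g u) s)
             r rho rho h' t); auto.
    - intros u s Hs. apply (is_derive_push H (g u) s H_C1), push_dom. lra.
    - intros u s Hs. apply slope_bound. lra.
    - intros u. apply Hr.
    - intros u. apply Hr.
    - apply (C1_is_derive_curve Om H (fun u => fst (g u) + r t * dx H (g u))
               (fun u => snd (g u) + r t * dy H (g u)) t);
        [exact Om_open|exact H_C1|exact (push_dom t (r t) (Hr' t))| |].
      + apply (is_derive_plus (fun u => fst (g u)) (fun u => r t * dx H (g u)));
          [apply Dg1|]. apply (is_derive_scal (fun u => dx H (g u))), Dn1.
      + apply (is_derive_plus (fun u => snd (g u)) (fun u => r t * dy H (g u)));
          [apply Dg2|]. apply (is_derive_scal (fun u => dy H (g u))), Dn2.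
    - apply (continuous_slope (fun w : R * R => g (fst w)) snd).
      + apply (continuous_comp fst g); [apply continuous_proj1|apply Cg].
      + apply continuous_proj2.
      + apply g_sol.
      + exact (push_dom t (r t) (Hr' t)). }
  destruct Dr as [r' Dr].
  assert (Cr : forall t, continuous r t).
  { intros t. apply (@ex_derive_continuous R_AbsRing R_NormedModule). now exists (r' t). }
  assert (Sp : forall t, rho <= slope H (g t) (r t)) by (intros t; apply slope_bound, Hr').
  set (lam := fun t => (slope H (g t) 0 + r t * twist H (g t)) / slope H (g t) (r t)).
  exists r, lam. split; [exact Hr|split; [|split]].
  - intros t.
    assert (S0 : continuous (fun t => slope H (g t) 0) t).
    { apply (continuous_slope g (fun _ => 0)); auto.
      - apply continuous_const.
      - apply g_sol.
      - rewrite push_0. apply g_sol. }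
    assert (S1 : continuous (fun t => slope H (g t) (r t)) t).
    { apply (continuous_slope g r); auto. apply g_sol. }
    assert (S2 : continuous (fun t => twist H (g t)) t).
    { apply (continuous_twist g); auto. apply g_sol. }
    apply (continuous_Rdiv (fun t => slope H (g t) 0 + r t * twist H (g t))
             (fun t => slope H (g t) (r t))).
    + exact (continuous_Rplus _ _ _ S0 (continuous_Rmult _ _ _ (Cr t) S2)).
    + exact S1.
    + generalize (Sp t). lra.
  - intros t.
    set (c1 := dy H (g t) + (r' t * dx H (g t) + r t * n1' t)).
    set (c2 := - dx H (g t) + (r' t * dy H (g t) + r t * n2' t)).
    assert (D1 : is_derive (fun s => fst (g s) + r s * dx H (g s)) t c1).
    { apply (is_derive_plus (fun u => fst (g u)) (fun u => r u * dx H (g u)));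
        [apply Dg1|]. apply (is_derive_mult r (fun u => dx H (g u)));
        [apply Dr|apply Dn1|apply Rmult_comm]. }
    assert (D2 : is_derive (fun s => snd (g s) + r s * dy H (g s)) t c2).
    { apply (is_derive_plus (fun u => snd (g u)) (fun u => r u * dy H (g u)));
        [apply Dg2|]. apply (is_derive_mult r (fun u => dy H (g u)));
        [apply Dr|apply Dn2|apply Rmult_comm]. }
    assert (Ec : dx H (push H (g t) (r t)) * c1 + dy H (push H (g t) (r t)) * c2 = 0).
    { assert (Dc : is_derive (fun s => H (push H (g s) (r s))) t
              (dx H (push H (g t) (r t)) * c1 + dy H (push H (g t) (r t)) * c2)).
      { apply (C1_is_derive_curve Om H (fun s => fst (g s) + r s * dx H (g s))
                 (fun s => snd (g s) + r s * dy H (g s)) t);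
          [exact Om_open|exact H_C1|exact (push_dom t (r t) (Hr' t))
          |exact D1|exact D2]. }
      rewrite <- (is_derive_unique _ _ _ Dc).
      rewrite (Derive_ext _ (fun _ => h')); [apply Derive_const|]. intros s. apply Hr. }
    replace (scal (lam t) (V_H H (push H (g t) (r t)))) with (c1, c2);
      [exact (is_derive_pair _ _ _ _ _ D1 D2)|].
    rewrite scal_pair. unfold V_H; simpl.
    generalize (Sp t). unfold lam. intros St.
    assert (En : slope H (g t) 0 + r t * twist H (g t) = c1 * dy H (g t) - c2 * dx H (g t)).
    { unfold slope. rewrite push_0. unfold twist, c1, c2, n1', n2'. ring. }
    rewrite En.
    assert (Es : slope H (g t) (r t) =
       dx H (push H (g t) (r t)) * dx H (g t) + dy H (push H (g t) (r t)) * dy H (g t))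
      by reflexivity.
    revert St Ec Es. generalize (dx H (push H (g t) (r t))) (dy H (push H (g t) (r t)))
      (slope H (g t) (r t)) (dx H (g t)) (dy H (g t)). intros p q S a b St Ec Es.
    assert (HS : S <> 0) by lra.
    f_equal; apply (Rmult_eq_reg_r S); try exact HS.
    + replace ((c1 * b - c2 * a) / S * q * S) with ((c1 * b - c2 * a) * q) by (field; exact HS).
      rewrite Es. replace (c1 * (p * a + q * b)) with
        ((c1 * b - c2 * a) * q + a * (p * c1 + q * c2)) by ring. rewrite Ec; ring.
    + replace ((c1 * b - c2 * a) / S * - p * S) with ((c1 * b - c2 * a) * - p) by (field; exact HS).
      rewrite Es. replace (c2 * (p * a + q * b)) with
        ((c1 * b - c2 * a) * - p + b * (p * c1 + q * c2)) by ring. rewrite Ec; ring.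
  - intros t.
    assert (R0 : Rabs 0 <= rho) by (rewrite Rabs_R0; lra).
    destruct (level_increment (g t) rho (push_dom t) 0 (r t) R0 (Hr' t)) as [x1 [Hx1 E1]].
    destruct (slope_increment (g t) rho rho_pos (push_dom t) (r t) (Hr' t)) as [x2 [Hx2 E2]].
    rewrite push_0, g_level, Rminus_0_r, (proj2 (Hr t)) in E1.
    generalize (slope_bound t x1 Hx1) (Sp t). intros S1 S2.
    replace (lam t - 1 - (h' - h) * dilation H (g t)) with
      (((twist H (g t) - curv H (g t) x2) / (slope H (g t) x1 * slope H (g t) (r t))
            - dilation H (g t)) * (h' - h)).
    + rewrite Rabs_mult. apply Rmult_le_compat_r; [apply Rabs_pos|].
      apply dilation_close; auto.
    + unfold lam. rewrite E1.
      replace (slope H (g t) 0) with (slope H (g t) (r t) - curv H (g t) x2 * r t)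
        by (rewrite <- E2; ring).
      field. lra.
Qed.

End Displaced_cycle.

(** At a point of the cycle nearest to [p] the vector to [p] is orthogonal to the
    velocity, hence parallel to the gradient. *)
Lemma nearest_point (g : R -> R * R) (T t0 : R) (p : R * R) :
  is_solution Om (V_H H) g -> 0 < T -> periodic g T -> (forall t, 0 < slope H (g t) 0) ->
  exists t r, p = push H (g t) r /\
    r * r * slope H (g t) 0 <=
      (fst p - fst (g t0)) * (fst p - fst (g t0)) +
      (snd p - snd (g t0)) * (snd p - snd (g t0)).
Proof.
  intros Hg HT PT Hs.
  set (a := fun t => fst p - fst (g t)). set (b := fun t => snd p - snd (g t)).
  set (d := fun t => a t * a t + b t * b t).
  assert (Da : forall t, is_derive a t (0 - dy H (g t))).
  { intros t. apply (is_derive_minus (fun _ => fst p) (fun s => fst (g s))).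
    - apply @is_derive_const.
    - exact (is_derive_fst _ _ _ (proj2 (Hg t))). }
  assert (Db : forall t, is_derive b t (0 - - dx H (g t))).
  { intros t. apply (is_derive_minus (fun _ => snd p) (fun s => snd (g s))).
    - apply @is_derive_const.
    - exact (is_derive_snd _ _ _ (proj2 (Hg t))). }
  assert (Dd : forall t, is_derive d t
             (2 * (a t * (0 - dy H (g t)) + b t * (0 - - dx H (g t))))).
  { intros t. apply is_derive_sum_squares; auto. }
  destruct (continuity_ab_min d 0 T) as [t [Hmin Ht]]; [lra| |].
  { intros t _. apply continuity_pt_filterlim.
    apply (@ex_derive_continuous R_AbsRing R_NormedModule). eexists. apply Dd. }
  assert (Hglob : forall s, d t <= d s).
  { intros s. destruct (periodic_reduce g T s HT PT) as [u [Hu E]].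
    replace (d s) with (d u) by (unfold d, a, b; now rewrite E). now apply Hmin. }
  assert (D0 : a t * (0 - dy H (g t)) + b t * (0 - - dx H (g t)) = 0).
  { generalize (Dd t). rewrite is_derive_Reals. intros D.
    generalize (deriv_minimum d (t - 1) (t + 1) t (exist _ _ D)
      ltac:(lra) ltac:(lra) (fun s _ _ => Hglob s)). simpl. lra. }
  exists t, ((a t * dx H (g t) + b t * dy H (g t)) / slope H (g t) 0).
  generalize (Hs t) (Hglob t0). unfold d at 2. fold (a t0) (b t0). intros Hst Hle.
  assert (Es : slope H (g t) 0 = dx H (g t) * dx H (g t) + dy H (g t) * dy H (g t)).
  { unfold slope. now rewrite push_0. }
  unfold push.
  assert (E1 : (a t * dx H (g t) + b t * dy H (g t)) / slope H (g t) 0 * dx H (g t) = a t).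
  { apply (Rmult_eq_reg_r (slope H (g t) 0)); [|lra].
    replace ((a t * dx H (g t) + b t * dy H (g t)) / slope H (g t) 0 * dx H (g t) *
      slope H (g t) 0) with ((a t * dx H (g t) + b t * dy H (g t)) * dx H (g t))
      by (field; lra).
    rewrite Es.
    replace (a t * (dx H (g t) * dx H (g t) + dy H (g t) * dy H (g t))) with
      ((a t * dx H (g t) + b t * dy H (g t)) * dx H (g t) - dy H (g t) *
         (a t * (0 - dy H (g t)) + b t * (0 - - dx H (g t)))) by ring.
    rewrite D0. ring. }
  assert (E2 : (a t * dx H (g t) + b t * dy H (g t)) / slope H (g t) 0 * dy H (g t) = b t).
  { apply (Rmult_eq_reg_r (slope H (g t) 0)); [|lra].
    replace ((a t * dx H (g t) + b t * dy H (g t)) / slope H (g t) 0 * dy H (g t) *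
      slope H (g t) 0) with ((a t * dx H (g t) + b t * dy H (g t)) * dy H (g t))
      by (field; lra).
    rewrite Es.
    replace (b t * (dx H (g t) * dx H (g t) + dy H (g t) * dy H (g t))) with
      ((a t * dx H (g t) + b t * dy H (g t)) * dy H (g t) + dx H (g t) *
         (a t * (0 - dy H (g t)) + b t * (0 - - dx H (g t)))) by ring.
    rewrite D0. ring. }
  revert E1 E2.
  generalize ((a t * dx H (g t) + b t * dy H (g t)) / slope H (g t) 0).
  intros r E1 E2. split.
  - rewrite E1, E2. unfold a, b. destruct p; simpl. f_equal; ring.
  - replace (r * r * slope H (g t) 0) with
      ((r * dx H (g t)) * (r * dx H (g t)) + (r * dy H (g t)) * (r * dy H (g t)))
      by (rewrite Es; ring).
    rewrite E1, E2. exact Hle.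
Qed.

Lemma V_H_C1 : C1_field Om (V_H H).
Proof.
  split; unfold V_H; simpl.
  - exact dyH_C1.
  - destruct dxH_C1 as [Hc [Hd [[Hx _] [Hy _]]]].
    assert (Ex : forall z, dx (fun w => - dx H w) z = - dx (dx H) z).
    { intros z. apply Derive_opp. }
    assert (Ey : forall z, dy (fun w => - dx H w) z = - dy (dx H) z).
    { intros z. apply Derive_opp. }
    split; [|split; [|split; (split; [|exact I])]].
    + intros z Hz. apply @continuous_opp. now apply Hc.
    + intros z Hz. destruct (Hd z Hz) as [H1 H2]. split.
      * exact (ex_derive_opp _ _ H1).
      * exact (ex_derive_opp _ _ H2).
    + intros z Hz. apply (continuous_ext (fun w => - dx (dx H) w)); [now intros w; rewrite Ex|].
      apply @continuous_opp. now apply Hx.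
    + intros z Hz. apply (continuous_ext (fun w => - dy (dx H) w)); [now intros w; rewrite Ey|].
      apply @continuous_opp. now apply Hy.
Qed.

Lemma H_constant (g : R -> R * R) (t : R) :
  is_solution Om (V_H H) g -> H (g t) = H (g 0).
Proof.
  intros Hg.
  destruct (MVT_gen (fun s => H (g s)) 0 t
    (fun s => dx H (g s) * dy H (g s) + dy H (g s) * - dx H (g s))) as [s [_ E]].
  - intros s _. apply (is_derive_along H g s H_C1 Hg).
  - intros s _. apply continuity_pt_filterlim.
    apply (@ex_derive_continuous R_AbsRing R_NormedModule (fun s => H (g s))).
    eexists. apply (is_derive_along H g s H_C1 Hg).
  - lra.
Qed.

(** * Tubes around the cycles of an annulus *)

Variable A : R * R -> Prop.
Hypothesis A_open : open A.
Hypothesis A_Om : subset A Om.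
Hypothesis A_cycles : forall z, A z ->
  exists C, nontrivial_cycle Om (V_H H) C /\ C z /\ subset C A.
Hypothesis A_regular : forall z, A z -> 0 < slope H z 0.

(** The field does not vanish in [A], so the cycles have a minimal period. *)
Lemma cycle_through (z : R * R) :
  A z -> exists g T, is_solution Om (V_H H) g /\ g 0 = z /\ (forall t, A (g t)) /\
    minimal_period g T.
Proof.
  intros Hz. destruct (A_cycles z Hz) as [C [[g [Hg [[s [Hs Ps]] [_ HC]]]] [Cz CA]]].
  destruct (proj1 (HC z) Cz) as [a Ha].
  assert (Hsol : is_solution Om (V_H H) (fun t => g (t + a))) by now apply is_solution_shift.
  assert (Hz0 : g (0 + a) = z) by now rewrite Rplus_0_l.
  destruct (minimal_period_exists (fun t => g (t + a)) (V_H H z)) as [T HT].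
  - rewrite <- Hz0. exact (proj2 (Hsol 0)).
  - intros E. generalize (A_regular z Hz). unfold slope. rewrite push_0.
    unfold V_H in E. injection E as E1 E2. rewrite E1.
    replace (dx H z) with 0 by lra. lra.
  - exists s. split; [exact Hs|]. intros t. rewrite <- (Ps (t + a)). f_equal. ring.
  - exists (fun t => g (t + a)), T. repeat split; auto; try apply Hsol; try apply HT.
    intros t. apply CA, HC. now exists (t + a).
Qed.

Lemma solution_in_annulus (g : R -> R * R) :
  is_solution Om (V_H H) g -> A (g 0) ->
  (forall t, A (g t)) /\ exists T, minimal_period g T.
Proof.
  intros Hg H0. destruct (cycle_through _ H0) as [g' [T [Hg' [E [HA HT]]]]].
  assert (Egg : forall t, g t = g' (t + 0)).
  { intros t. rewrite <- (solution_meet Om (V_H H) g g' 0 0 Om_open V_H_C1 Hg Hg' (eq_sym E)).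
    now rewrite Rplus_0_r. }
  split.
  - intros t. rewrite Egg. apply HA.
  - exists T. exact (minimal_period_shift g' g 0 T Egg HT).
Qed.

(** Away from the times 0 and [T] the cycle stays at a positive distance from its
    starting point, and a close enough curve inherits this. *)
Lemma orbit_separation (g : R -> R * R) (T a b : R) :
  is_solution Om (V_H H) g -> minimal_period g T -> 0 < a -> b < T ->
  exists d, 0 < d /\ forall t, a <= t <= b -> forall p, ball (g t) d p -> ~ ball (g 0) d p.
Proof.
  intros Hg [HT [PT HTmin]] Ha Hb.
  apply (uniform_on_segment (fun t d => forall p, ball (g t) d p -> ~ ball (g 0) d p)).
  - intros t e e' He [_ He'] p Hp Hp0. apply (He p); eapply ball_le; eauto.
  - intros t Ht.
    assert (Hne : g t <> g 0).
    { intros E. assert (T <= t); [|lra]. apply HTmin; [lra|].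
      replace t with (t - 0) by ring.
      apply (solution_return_periodic Om (V_H H) g 0 t Om_open V_H_C1 Hg). auto. }
    destruct (separated_nbhds _ _ Hne) as [d [Hd Bd]].
    destruct (continuous_ball g t d (is_derive_continuous_pair _ _ _ (proj2 (Hg t))) Hd)
      as [e [He Be]].
    exists (Rmin e d). split; [now apply Rmin_pos|].
    intros s Hs p Hp Hp0. apply (Bd (g s)) with p.
    + apply Be. eapply Rlt_le_trans; [exact Hs|apply Rmin_l].
    + eapply ball_le; [apply Rmin_r|exact Hp].
    + eapply ball_le; [apply Rmin_r|exact Hp0].
Qed.

Lemma orbit_open_nbhd (g : R -> R * R) (T : R) (O : R * R -> Prop) :
  (forall t, continuous g t) -> 0 < T -> periodic g T -> open O -> (forall t, O (g t)) ->
  exists d, 0 < d /\ forall t p, ball (g t) d p -> O p.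
Proof.
  intros Hg HT PT HO HOg.
  apply (uniform_on_cycle g T (fun z d => forall p, ball z d p -> O p)); auto.
  - intros z e e' He [_ He'] p Hp. apply He. eapply ball_le; eauto.
  - intros t. destruct (HO _ (HOg t)) as [e He].
    exists (e / 2). split; [generalize (cond_pos e); lra|].
    intros z Hz p Hp. apply He. replace (pos e) with (e / 2 + e / 2) by field.
    now apply ball_triangle with z.
Qed.

Lemma push_uniformly_close (g : R -> R * R) (T d : R) :
  is_solution Om (V_H H) g -> 0 < T -> periodic g T -> 0 < d ->
  exists e, 0 < e /\ forall t r, Rabs r <= e -> ball (g t) d (push H (g t) r).
Proof.
  intros Hg HT PT Hd.
  apply (uniform_on_cycle g T (fun z e => forall r, Rabs r <= e -> ball z d (push H z r))); auto.
  - intros t. exact (is_derive_continuous_pair _ _ _ (proj2 (Hg t))).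
  - intros z e e' He [_ He'] r Hr. apply He. lra.
  - intros t.
    assert (C : continuous (fun w : (R * R) * R => push H (fst w) (snd w)) (g t, 0)).
    { apply (continuous_push fst snd).
      - apply continuous_proj1.
      - apply continuous_proj2.
      - apply Hg. }
    destruct (C (ball (push H (g t) 0) (d / 2))) as [e He].
    { exact (locally_ball _ (mkposreal (d / 2) ltac:(lra))). }
    rewrite push_0 in He.
    exists (Rmin (e / 2) (d / 2)).
    assert (0 < e) by apply cond_pos.
    split; [apply Rmin_pos; lra|]. intros z Hz r Hr.
    replace d with (d / 2 + d / 2) by field. apply ball_triangle with (g t).
    + apply ball_sym. eapply ball_le; [apply Rmin_r|exact Hz].
    + apply (He (z, r)). split.
      * eapply ball_le; [|exact Hz]. eapply Rle_trans; [apply Rmin_l|simpl; lra].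
      * change (Rabs (r - 0) < e). rewrite Rminus_0_r.
        eapply Rle_lt_trans; [exact Hr|]. eapply Rle_lt_trans; [apply Rmin_l|lra].
Qed.

Lemma estimates_along_cycle (g : R -> R * R) (T eta : R) :
  is_solution Om (V_H H) g -> (forall t, A (g t)) -> 0 < T -> periodic g T -> 0 < eta ->
  exists rho, 0 < rho /\ forall t, Rabs (dilation H (g t)) <= / rho /\
    forall r1 r2 r3, Rabs r1 <= rho -> Rabs r2 <= rho -> Rabs r3 <= rho ->
      Om (push H (g t) r1) /\ rho <= slope H (g t) r1 /\
      Rabs ((twist H (g t) - curv H (g t) r1) / (slope H (g t) r2 * slope H (g t) r3)
            - dilation H (g t)) <= eta.
Proof.
  intros Hg HA HT PT Heta.
  apply (uniform_on_cycle g T (fun z rho => Rabs (dilation H z) <= / rho /\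
    forall r1 r2 r3, Rabs r1 <= rho -> Rabs r2 <= rho -> Rabs r3 <= rho ->
      Om (push H z r1) /\ rho <= slope H z r1 /\
      Rabs ((twist H z - curv H z r1) / (slope H z r2 * slope H z r3)
            - dilation H z) <= eta)); auto.
  - intros t. exact (is_derive_continuous_pair _ _ _ (proj2 (Hg t))).
  - intros z e e' [H1 H2] [He' Hle]. split.
    + eapply Rle_trans; [exact H1|]. apply Rinv_le_contravar; lra.
    + intros r1 r2 r3 R1 R2 R3.
      destruct (H2 r1 r2 r3) as [K1 [K2 K3]]; try lra.
      repeat split; auto. lra.
  - intros t. apply (local_estimates Om); auto; apply Hg.
Qed.

(** Near a cycle the annulus looks like a product.  The cycles of the nearby levels
    are obtained by displacing [g], stay in the given neighbourhood [O], and cover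
    a full neighbourhood of [g], because a point [p] near [g] lies on the normal
    line at a point of [g] nearest to it.  The last clause is the first-order
    expansion of the period. *)
Lemma tube (g : R -> R * R) (T : R) (O : R * R -> Prop) (eta : R) :
  is_solution Om (V_H H) g -> (forall t, A (g t)) -> minimal_period g T ->
  open O -> (forall t, O (g t)) -> 0 < eta ->
  exists d eps, 0 < d /\ 0 < eps /\
    (forall t p, ball (g t) d p -> O p /\ A p) /\
    forall h', Rabs (h' - H (g 0)) < eps ->
      exists g' P, is_solution Om (V_H H) g' /\ A (g' 0) /\ H (g' 0) = h' /\
        (forall s, exists t, ball (g t) d (g' s)) /\
        (forall t p, ball (g t) d p -> H p = h' -> orbit g' p) /\
        minimal_period g' P /\
        Rabs (P - T - (h' - H (g 0)) * RInt (fun t => dilation H (g t)) 0 T)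
          <= eta * Rabs (h' - H (g 0)).
Proof.
  intros Hg HA HTmin HO HOg Heta.
  assert (HT : 0 < T) by apply HTmin. assert (PT : periodic g T) by apply HTmin.
  assert (Cg : forall t, continuous g t).
  { intros t. exact (is_derive_continuous_pair _ _ _ (proj2 (Hg t))). }
  assert (HetaT : 0 < eta / T) by now apply Rdiv_lt_0_compat.
  destruct (estimates_along_cycle g T (eta / T) Hg HA HT PT HetaT)
    as [rho [Hrho Est]].
  destruct (orbit_separation g T (T / 12) (11 * T / 12) Hg HTmin
              ltac:(lra) ltac:(lra)) as [d1 [Hd1 Sep]].
  destruct (orbit_open_nbhd g T (fun z => O z /\ A z) Cg HT PT) as [d2 [Hd2 Nb]].
  { now apply open_and. }
  { auto. }
  (* The last term ensures that a point within [d] of the cycle is displaced by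
     at most [rho] from its nearest point: the squared distance is at most
     [2 * d ^ 2], and it equals the squared displacement times a slope that is
     at least [rho]. *)
  set (d := Rmin (Rmin d1 d2) (rho / 2 * Rmin 1 rho)).
  assert (Hd : 0 < d).
  { unfold d. repeat apply Rmin_pos; auto. apply Rmult_lt_0_compat; [lra|].
    apply Rmin_pos; lra. }
  assert (dd1 : d <= d1) by (unfold d; eapply Rle_trans; [apply Rmin_l|apply Rmin_l]).
  assert (dd2 : d <= d2) by (unfold d; eapply Rle_trans; [apply Rmin_l|apply Rmin_r]).
  assert (dsq : 2 * (d * d) <= rho * rho * rho / 2).
  { assert (d <= rho / 2 * Rmin 1 rho) by apply Rmin_r.
    assert (0 < Rmin 1 rho) by (apply Rmin_pos; lra).
    generalize (Rmin_l 1 rho) (Rmin_r 1 rho). intros.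
    assert (d * d <= (rho / 2 * Rmin 1 rho) * (rho / 2 * Rmin 1 rho))
      by (apply Rmult_le_compat; lra).
    assert (Rmin 1 rho * Rmin 1 rho <= 1 * rho) by (apply Rmult_le_compat; lra).
    assert (rho * rho * (Rmin 1 rho * Rmin 1 rho) <= rho * rho * (1 * rho))
      by (apply Rmult_le_compat_l; nra). lra. }
  clearbody d.
  destruct (push_uniformly_close g T d Hg HT PT Hd) as [rho2 [Hrho2 Close]].
  set (h := H (g 0)).
  assert (Hlev : forall t, H (g t) = h).
  { intros t. apply (H_constant g t Hg). }
  assert (Pdom : forall t r, Rabs r <= rho -> Om (push H (g t) r)).
  { intros t r Hr. apply (proj2 (Est t) r r r); auto. }
  assert (Sb : forall t r, Rabs r <= rho -> rho <= slope H (g t) r).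
  { intros t r Hr. apply (proj2 (Est t) r r r); auto. }
  assert (Hsep : forall t, 0 < slope H (g t) 0) by (intros t; apply A_regular, HA).
  assert (Bpos : 0 < / rho + eta / T).
  { generalize (Rinv_0_lt_compat _ Hrho). lra. }
  (* The first bound keeps the displacement below [rho] and [rho2], the second
     keeps [lam] within [1 / 2] of 1. *)
  set (eps := Rmin (rho * Rmin rho rho2) (/ 2 / (/ rho + eta / T))).
  assert (Heps : 0 < eps).
  { unfold eps. apply Rmin_pos.
    - apply Rmult_lt_0_compat; [exact Hrho|]. now apply Rmin_pos.
    - apply Rdiv_lt_0_compat; lra. }
  exists d, eps. split; [exact Hd|split; [exact Heps|split]].
  { intros t p Hp. apply (Nb t). eapply ball_le; eauto. }
  intros h' Hh.
  assert (Hh1 : Rabs (h' - h) < rho * Rmin rho rho2)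
    by (eapply Rlt_le_trans; [exact Hh|apply Rmin_l]).
  assert (Hh2 : Rabs (h' - h) * (/ rho + eta / T) < / 2).
  { apply (Rmult_lt_reg_r (/ (/ rho + eta / T))); [now apply Rinv_0_lt_compat|].
    rewrite Rmult_assoc, Rinv_r, Rmult_1_r by lra.
    eapply Rlt_le_trans; [exact Hh|apply Rmin_r]. }
  assert (Hh3 : Rabs (h' - h) < rho * rho).
  { eapply Rlt_le_trans; [exact Hh1|]. apply Rmult_le_compat_l; [lra|apply Rmin_l]. }
  destruct (displaced_cycle g h rho (eta / T) Hg Hlev Hrho Pdom Sb
    (fun t r1 r2 r3 R1 R2 R3 => proj2 (proj2 (proj2 (Est t) r1 r2 r3 R1 R2 R3))) h' Hh3)
    as [r [lam [Hr [Cl [Dc Bl]]]]].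
  set (c := fun t => push H (g t) (r t)).
  assert (Hr' : forall t, Rabs (r t) <= rho) by (intros t; left; apply Hr).
  assert (cB : forall t, ball (g t) d (c t)).
  { intros t. apply Close. apply (Rmult_le_reg_l rho); [exact Hrho|].
    eapply Rle_trans.
    - apply (displacement_bound (g t) rho Hrho (Pdom t) (Sb t) _ (Hr' t)).
    - rewrite (proj2 (Hr t)), Hlev. left. eapply Rlt_le_trans; [exact Hh1|].
      apply Rmult_le_compat_l; [lra|apply Rmin_r]. }
  assert (cA : forall t, A (c t)).
  { intros t. apply (Nb t). eapply ball_le; [exact dd2|apply cB]. }
  destruct (cycle_through (c 0) (cA 0))
    as [g' [T' [Hg' [E0 [HA' HT']]]]].
  assert (Lb : forall t, / 2 <= lam t <= 3 / 2).
  { intros t. generalize (Bl t) (proj1 (Est t)). intros B1 B2.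
    assert (Rabs (lam t - 1) < / 2).
    { eapply Rle_lt_trans; [|exact Hh2].
      replace (lam t - 1) with ((lam t - 1 - (h' - h) * dilation H (g t)) +
        (h' - h) * dilation H (g t)) by ring.
      eapply Rle_trans; [apply Rabs_triang|]. rewrite (Rabs_mult (h' - h)).
      generalize (Rmult_le_compat_l _ _ _ (Rabs_pos (h' - h)) B2). lra. }
    assert (H1 : - / 2 < lam t - 1 < / 2) by (apply Rabs_def2 in H0; lra). lra. }
  assert (cT : c T = c 0).
  { unfold c. replace (g T) with (g 0) by (rewrite <- (PT 0); f_equal; ring).
    f_equal. apply (displacement_unique (g 0) rho Hrho (Pdom 0) (Sb 0)); auto.
    rewrite (proj2 (Hr 0)). replace (g 0) with (g T) by (rewrite <- (PT 0); f_equal; ring).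
    apply Hr. }
  destruct (reparametrized_cycle Om (V_H H) g' c lam T T' Om_open (V_H_C1)
              Hg' HT' Cl Lb (fun t => conj (A_Om _ (cA t)) (Dc t)) HT cT E0)
    as [MP [Follow Cover]].
  { intros t Ht E. apply (Sep t Ht (c t)).
    - eapply ball_le; [exact dd1|apply cB].
    - rewrite E. eapply ball_le; [exact dd1|apply cB]. }
  exists g', (RInt lam 0 T). split; [exact Hg'|].
  split; [apply HA'|]. split; [rewrite E0; apply Hr|].
  split; [|split; [|split]]; [| |exact MP|].
  - intros s. destruct (Cover s) as [t ->]. exists t. apply cB.
  - intros t p Hp Hph.
    destruct (nearest_point g T t p Hg HT PT Hsep) as [u [s [-> Hs]]].
    destruct Hp as [Hp1 Hp2].
    change (Rabs (fst (push H (g u) s) - fst (g t)) < d) in Hp1.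
    change (Rabs (snd (push H (g u) s) - snd (g t)) < d) in Hp2.
    assert (Hs' : Rabs s <= rho).
    { assert (R0 : Rabs 0 <= rho) by (rewrite Rabs_R0; lra).
      generalize (Sb u 0 R0). intros Su.
      apply Rabs_def2 in Hp1. apply Rabs_def2 in Hp2.
      revert Hs Hp1 Hp2. generalize (fst (push H (g u) s) - fst (g t))
        (snd (push H (g u) s) - snd (g t)). intros x y Hs Hx Hy.
      assert (x * x <= d * d) by nra. assert (y * y <= d * d) by nra.
      assert (s * s * rho <= s * s * slope H (g u) 0)
        by (apply Rmult_le_compat_l; [nra|exact Su]).
      assert (s * s * rho <= rho * rho * rho) by nra.
      assert (s * s <= rho * rho) by (apply (Rmult_le_reg_r rho); lra).
      apply Rsqr_le_abs_0 in H4. rewrite (Rabs_right rho) in H4; lra. }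
    assert (Es : s = r u).
    { apply (displacement_unique (g u) rho Hrho (Pdom u) (Sb u)); auto.
      rewrite (proj2 (Hr u)). exact Hph. }
    rewrite Es. exists (RInt lam 0 u). apply Follow.
  - replace (eta * Rabs (h' - h)) with (T * (eta / T * Rabs (h' - h))) by (field; lra).
    apply RInt_first_order; auto.
    intros t. apply (continuous_dilation g); [apply Cg|apply Hg|].
    generalize (Hsep t). lra.
Qed.

(** * Level sets in the annulus are single cycles *)

Definition same_orbit (p q : R * R) : Prop :=
  exists g a b, is_solution Om (V_H H) g /\ g a = p /\ g b = q.

Lemma same_orbit_solution (g : R -> R * R) (a : R) (q : R * R) :
  is_solution Om (V_H H) g -> same_orbit (g a) q -> orbit g q.
Proof.
  intros Hg [g' [a' [b' [Hg' [Ha Hb]]]]]. exists (b' - a' + a).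
  rewrite <- (solution_meet Om (V_H H) g' g a' a Om_open V_H_C1 Hg' Hg Ha).
  now replace (b' - a' + a') with b' by ring.
Qed.

Lemma same_orbit_trans (p q w : R * R) :
  same_orbit p q -> same_orbit q w -> same_orbit p w.
Proof.
  intros [g [a [b [Hg [<- <-]]]]] H2.
  destruct (same_orbit_solution g b w Hg H2) as [c Hc]. exists g, a, c. auto.
Qed.

(** A union of cycles containing exactly one cycle for each level of an interval: a
    local section of [H] on the space of cycles. *)
Definition tower (S : R * R -> Prop) : Prop :=
  open S /\ subset S A /\
  (forall p q, S p -> same_orbit p q -> S q) /\
  (forall p q h, S p -> S q -> H p <= h <= H q -> exists w, S w /\ H w = h) /\
  (forall p q, S p -> S q -> H p = H q -> same_orbit p q).

(** The displacement along the gradient reaches all nearby levels. *)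
Lemma H_open_map (O : R * R -> Prop) (z : R * R) :
  open O -> O z -> A z ->
  exists e, 0 < e /\ forall h, Rabs (h - H z) < e -> exists w, O w /\ H w = h.
Proof.
  intros HO Oz Az.
  destruct (local_estimates (fun w => O w /\ Om w) z 1) as [rho [Hrho Est]];
    auto; try lra.
  { now apply open_and. }
  generalize (proj2 (Est z (ball_center z (mkposreal rho Hrho)))). intros E.
  exists (rho * rho). split; [nra|]. intros h Hh.
  destruct (displacement_exists z rho Hrho) with (h' := h)
    as [r [Hr Er]]; auto.
  - intros r Hr. now apply (E r r r).
  - intros r Hr. now apply (E r r r).
  - exists (push H z r). split; [|exact Er]. apply (E r r r); lra.
Qed.

(** The points of a tube whose level is close enough form a tower. *)
Lemma tower_nbhd (z : R * R) (O : R * R -> Prop) :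
  A z -> open O -> (forall w, same_orbit z w -> O w) ->
  exists N, tower N /\ N z /\ subset N O.
Proof.
  intros Az HO Oz.
  destruct (cycle_through z Az) as [g [T [Hg [<- [HA HT]]]]].
  assert (HOg : forall t, O (g t)).
  { intros t. apply Oz. exists g, 0, t. auto. }
  destruct (tube g T O 1 Hg HA HT HO HOg Rlt_0_1)
    as [d [eps [Hd [Heps [Nb Lev]]]]].
  set (N := fun p => (exists t, ball (g t) d p) /\ Rabs (H p - H (g 0)) < eps).
  assert (Same : forall p, N p -> exists g', is_solution Om (V_H H) g' /\ H (g' 0) = H p /\
     (forall s, N (g' s)) /\ forall q, N q -> H q = H p -> orbit g' q).
  { intros p [_ Hp].
    destruct (Lev (H p) Hp) as [g' [P [Hg' [_ [E [Near [Orb _]]]]]]].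
    exists g'. split; [exact Hg'|split; [exact E|split]].
    - intros s. split; [apply Near|]. now rewrite (H_constant g' s Hg'), E.
    - intros q [[t Hq] _] Eq. now apply (Orb t). }
  exists N. split; [split; [|split; [|split; [|split]]]|split].
  - intros p [[t Ht] Hp].
    apply filter_and.
    + generalize (open_ball_plane (g t) d p Ht). apply filter_imp.
      intros q Hq. now exists t.
    + assert (H0 : Om p) by (apply A_Om, (Nb t p Ht)).
      generalize (continuous_close H p (eps - Rabs (H p - H (g 0)))
        (proj1 H_C1 p H0) ltac:(lra)).
      apply filter_imp. intros q Hq.
      replace (H q - H (g 0)) with ((H q - H p) + (H p - H (g 0))) by ring.
      eapply Rle_lt_trans; [apply Rabs_triang|lra].
  - intros p [[t Ht] _]. now apply (Nb t).
  - intros p q Np Hpq. destruct (Same p Np) as [g' [Hg' [_ [HN Orb]]]].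
    destruct (Orb p Np eq_refl) as [s <-].
    destruct (same_orbit_solution g' s q Hg' Hpq) as [u <-]. apply HN.
  - intros p q h [_ Hp] [_ Hq] Hh.
    assert (Hh' : Rabs (h - H (g 0)) < eps).
    { apply Rabs_def2 in Hp. apply Rabs_def2 in Hq. apply Rabs_def1; lra. }
    destruct (Lev h Hh') as [g' [P [Hg' [_ [E [Near _]]]]]].
    exists (g' 0). split; [split; [apply Near|now rewrite E]|exact E].
  - intros p q Np Nq E. destruct (Same p Np) as [g' [Hg' [_ [_ Orb]]]].
    destruct (Orb p Np eq_refl) as [s Hs]. destruct (Orb q Nq (eq_sym E)) as [u Hu].
    exists g', s, u. auto.
  - split; [exists 0; exact (ball_center (g 0) (mkposreal d Hd))|].
    now rewrite Rminus_diag, Rabs_R0.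
  - intros p [[t Ht] _]. now apply (Nb t).
Qed.

(** The space of cycles is Hausdorff: a cycle is compact, so it has a neighbourhood
    that stays away from a point outside it, and a tower fits inside. *)
Lemma tower_disjoint_nbhds (S : R * R -> Prop) (s s' : R * R) :
  tower S -> S s -> ~ same_orbit s s' ->
  exists N d, tower N /\ N s /\ subset N S /\ 0 < d /\ forall p, N p -> ~ ball s' d p.
Proof.
  intros [HS [SA [Sat _]]] Ss Hn.
  destruct (cycle_through s (SA s Ss)) as [g [T [Hg [E0 [HA HT]]]]].
  destruct (uniform_on_cycle g T (fun z d => forall p, ball z d p -> ~ ball s' d p))
    as [d [Hd Bd]]; try apply HT.
  - intros t. exact (is_derive_continuous_pair _ _ _ (proj2 (Hg t))).
  - intros z e e' He [_ He'] p Hp Hp'. apply (He p); eapply ball_le; eauto.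
  - intros t. apply separated_nbhds. intros E. apply Hn. exists g, 0, t. auto.
  - destruct (tower_nbhd s (fun p => S p /\ exists t, ball (g t) d p)) as [N [HN [Ns NO]]].
    + now apply SA.
    + apply open_and; [exact HS|]. intros p [t Ht].
      generalize (open_ball_plane (g t) d p Ht). apply filter_imp.
      intros q Hq. now exists t.
    + intros w Hw. split; [now apply (Sat s)|].
      rewrite <- E0 in Hw. destruct (same_orbit_solution g 0 w Hg Hw) as [t <-].
      exists t. exact (ball_center (g t) (mkposreal d Hd)).
    + exists N, d. split; [exact HN|split; [exact Ns|split; [|split; [exact Hd|]]]].
      * intros p Np. now apply NO.
      * intros p Np. destruct (NO p Np) as [_ [t Ht]]. now apply (Bd t).
Qed.

(** The levels at which the two towers have a common cycle form an open set, as [H]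
    is an open map.  They also form a closed set among the levels that both towers
    reach: if at such a limit level the cycles of the two towers were distinct,
    they would have disjoint neighbourhoods, although they are limits of common
    cycles.  The set contains the level of [w], so it is everything. *)
Lemma towers_agree (S S' : R * R -> Prop) (w p q : R * R) :
  tower S -> tower S' -> S w -> S' w -> S p -> S' q -> H p = H q -> same_orbit p q.
Proof.
  intros HS HS' Sw Sw' Sp Sq E.
  pose proof HS as [HO [SA [Sat [Conv Inj]]]].
  pose proof HS' as [HO' [SA' [Sat' [Conv' Inj']]]].
  assert (C : exists x, S x /\ S' x /\ H x = H p).
  { apply (interval_connected
      (fun h => (exists a, S a /\ H a = h) /\ (exists b, S' b /\ H b = h))
      (fun h => exists x, S x /\ S' x /\ H x = h) (H w)).
    - intros a b h [[a1 [Ha1 <-]] [a2 [Ha2 Ea]]] [[b1 [Hb1 <-]] [b2 [Hb2 Eb]]] Hh.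
      split; [now apply (Conv a1 b1)|]. apply (Conv' a2 b2); auto; lra.
    - split; exists w; auto.
    - exists w. auto.
    - intros h _ [x [Sx [Sx' <-]]].
      destruct (H_open_map (fun z => S z /\ S' z) x) as [e [He Hx]]; auto.
      { now apply open_and. }
      exists e. split; [exact He|]. intros h' _ Hh'.
      destruct (Hx h' Hh') as [y [[Hy Hy'] Ey]]. now exists y.
    - intros h [[s [Ss Es]] [s' [Ss' Es']]] Lim.
      apply NNPP. intros Hn.
      assert (Hns : ~ same_orbit s s').
      { intros Hss. apply Hn. exists s'. split; [now apply (Sat s)|auto]. }
      destruct (tower_disjoint_nbhds S s s' HS Ss Hns) as [N [d [HN [Ns [NS [Hd Nd]]]]]].
      destruct HN as [ON [NA [SatN _]]].
      destruct (H_open_map N s) as [e1 [He1 L1]]; auto.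
      destruct (H_open_map (fun z => S' z /\ ball s' d z) s') as [e2 [He2 L2]]; auto.
      { apply open_and; [exact HO'|apply open_ball_plane]. }
      { split; [exact Ss'|exact (ball_center s' (mkposreal d Hd))]. }
      destruct (Lim (Rmin e1 e2)) as [y [_ [Hy [x [Sx [Sx' Ex]]]]]].
      { now apply Rmin_pos. }
      destruct (L1 y) as [n [Nn En]].
      { rewrite Es. eapply Rlt_le_trans; [exact Hy|apply Rmin_l]. }
      destruct (L2 y) as [b [[Sb Bb] Eb]].
      { rewrite Es'. eapply Rlt_le_trans; [exact Hy|apply Rmin_r]. }
      apply (Nd b); [|exact Bb]. apply (SatN n); [exact Nn|].
      apply same_orbit_trans with x.
      + apply Inj; auto. now rewrite En.
      + apply Inj'; auto. now rewrite Eb.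
    - split; [now exists p|now exists q]. }
  destruct C as [x [Sx [Sx' Ex]]].
  apply same_orbit_trans with x; [apply Inj|apply Inj']; auto. now rewrite Ex.
Qed.

Lemma tower_union (S S' : R * R -> Prop) (w : R * R) :
  tower S -> tower S' -> S w -> S' w -> tower (fun z => S z \/ S' z).
Proof.
  intros HS HS' Sw Sw'.
  generalize (towers_agree S S' w) (towers_agree S' S w). intros Ag Ag'.
  pose proof HS as [HO [SA [Sat [Conv Inj]]]].
  pose proof HS' as [HO' [SA' [Sat' [Conv' Inj']]]].
  split; [now apply open_or|split; [|split; [|split]]].
  - intros z [Hz|Hz]; auto.
  - intros p q [Hp|Hp] Hpq; [left; now apply (Sat p)|right; now apply (Sat' p)].
  - assert (CS : forall p q h, S p -> S q -> H p <= h <= H q ->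
              exists x, (S x \/ S' x) /\ H x = h).
    { intros p q h Hp Hq Hh. destruct (Conv p q h Hp Hq Hh) as [x [Hx Ex]]. exists x. auto. }
    assert (CS' : forall p q h, S' p -> S' q -> H p <= h <= H q ->
              exists x, (S x \/ S' x) /\ H x = h).
    { intros p q h Hp Hq Hh. destruct (Conv' p q h Hp Hq Hh) as [x [Hx Ex]]. exists x. auto. }
    intros p q h [Hp|Hp] [Hq|Hq] Hh.
    + now apply (CS p q).
    + destruct (Rle_or_lt h (H w)); [apply (CS p w)|apply (CS' w q)]; auto; lra.
    + destruct (Rle_or_lt h (H w)); [apply (CS' p w)|apply (CS w q)]; auto; lra.
    + now apply (CS' p q).
  - intros p q [Hp|Hp] [Hq|Hq] E; auto.
Qed.

(** The points that share a tower with [p] form an open set.  So do the others: if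
    a tower around [z] contained a point sharing a tower with [p], the union of the
    two would be a tower containing [p] and [z].  By connectedness of [A] some
    tower contains both [p] and [q]. *)
Lemma level_set_single_orbit (p q : R * R) :
  connected A -> A p -> A q -> H p = H q -> same_orbit p q.
Proof.
  intros Acon Ap Aq E.
  assert (Nb : forall z, A z -> exists N, tower N /\ N z).
  { intros z Hz. destruct (tower_nbhd z A Hz A_open) as [N [HN [Nz _]]].
    - intros w [g [a [b [Hg [Ha <-]]]]].
      assert (HgA : A (g (0 + a))) by (rewrite Rplus_0_l, Ha; exact Hz).
      generalize (proj1 (solution_in_annulus (fun t => g (t + a))
        (is_solution_shift _ _ _ a Hg) HgA) (b - a)).
      now replace (b - a + a) with b by ring.
    - now exists N. }
  set (U := fun z => exists S, tower S /\ S p /\ S z).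
  set (W := fun z => A z /\ ~ U z).
  destruct (classic (U q)) as [[S [[_ [_ [_ [_ Inj]]]] [Sp Sq]]]|Hq]; [now apply Inj|].
  exfalso.
  destruct (Acon U W) as [z [_ [Uz [_ Wz]]]].
  - intros z [S [HS [Sp Sz]]]. generalize (proj1 HS z Sz). apply filter_imp.
    intros y Sy. now exists S.
  - intros z [Az Hz]. destruct (Nb z Az) as [N [HN Nz]].
    generalize (proj1 HN z Nz). apply filter_imp.
    intros y Ny. split; [now apply HN|]. intros [S [HS [Sp Sy]]]. apply Hz.
    exists (fun v => S v \/ N v). split; [now apply (tower_union S N y)|auto].
  - intros z Az. destruct (classic (U z)); [left|right; split]; auto.
  - exists p. split; [exact Ap|]. destruct (Nb p Ap) as [N [HN Np]]. now exists N.
  - exists q. split; [exact Aq|]. now split.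
  - exact (Wz Uz).
Qed.

End Hamiltonian_system.

(** * The bracket of the two fields and the divergence *)

Lemma norm_grad_sq (H : R * R -> R) (z : R * R) :
  norm (grad H z) ^ 2 = dx H z * dx H z + dy H z * dy H z.
Proof.
  change (sqrt (Rabs (dx H z) ^ 2 + Rabs (dy H z) ^ 2) ^ 2 =
          dx H z * dx H z + dy H z * dy H z).
  rewrite !pow2_abs, pow2_sqrt; [ring|]. nra.
Qed.

Lemma mixed_partials (Om : R * R -> Prop) (H : R * R -> R) (z : R * R) :
  open Om -> is_Ck 2 Om H -> Om z -> dx (dy H) z = dy (dx H) z.
Proof.
  intros HO HC2 Hz.
  destruct HC2 as [_ [D [[_ [Dx [_ [Cyx _]]]] [_ [Dy [[Cxy _] _]]]]]].
  destruct z as [a b].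
  apply (Schwarz (fun x y => H (x, y)) a b).
  - apply locally_2d_locally. generalize (HO _ Hz). apply filter_imp.
    intros [u v] Hw. repeat split; simpl.
    + exact (proj1 (D _ Hw)).
    + exact (proj2 (D _ Hw)).
    + exact (proj1 (Dy _ Hw)).
    + exact (proj2 (Dx _ Hw)).
  - apply continuity_2d_pt_filterlim.
    apply (continuous_ext (dx (dy H))); [now intros [u v]|exact (Cxy _ Hz)].
  - apply continuity_2d_pt_filterlim.
    apply (continuous_ext (dy (dx H))); [now intros [u v]|exact (Cyx _ Hz)].
Qed.

Lemma is_derive_over_sum_squares (a b : R -> R) (t a' b' : R) :
  is_derive a t a' -> is_derive b t b' -> a t * a t + b t * b t <> 0 ->
  is_derive (fun s => a s / (a s * a s + b s * b s)) t
    (a' / (a t * a t + b t * b t)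
     - a t * (2 * (a t * a' + b t * b')) / (a t * a t + b t * b t) ^ 2).
Proof.
  intros Ha Hb H0. auto_derive.
  - repeat split; try (eexists; eassumption). exact H0.
  - rewrite (Derive_eta _ _ _ Ha), (Derive_eta _ _ _ Hb). field. exact H0.
Qed.

Lemma W_H_partials (Om : R * R -> Prop) (H : R * R -> R) (z : R * R) (N : R) :
  is_Ck 2 Om H -> Om z -> N = dx H z * dx H z + dy H z * dy H z -> N <> 0 ->
  dx (fun w => fst (W_H H w)) z = dx (dx H) z / N
    - dx H z * (2 * (dx H z * dx (dx H) z + dy H z * dx (dy H) z)) / N ^ 2 /\
  dy (fun w => fst (W_H H w)) z = dy (dx H) z / N
    - dx H z * (2 * (dx H z * dy (dx H) z + dy H z * dy (dy H) z)) / N ^ 2 /\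
  dx (fun w => snd (W_H H w)) z = dx (dy H) z / N
    - dy H z * (2 * (dy H z * dx (dy H) z + dx H z * dx (dx H) z)) / N ^ 2 /\
  dy (fun w => snd (W_H H w)) z = dy (dy H) z / N
    - dy H z * (2 * (dy H z * dy (dy H) z + dx H z * dy (dx H) z)) / N ^ 2.
Proof.
  intros HC2 Hz -> HN.
  destruct HC2 as [_ [_ [[_ [Dx _]] [_ [Dy _]]]]].
  destruct (Dx z Hz) as [Dxx Dyx]. destruct (Dy z Hz) as [Dxy Dyy].
  apply Derive_correct in Dxx, Dyx, Dxy, Dyy.
  assert (HN' : dy H z * dy H z + dx H z * dx H z <> 0) by (rewrite Rplus_comm; exact HN).
  assert (E1 : forall w, fst (W_H H w) = dx H w / (dx H w * dx H w + dy H w * dy H w)).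
  { intros w. unfold W_H, fst. now rewrite norm_grad_sq. }
  assert (E2 : forall w, snd (W_H H w) = dy H w / (dy H w * dy H w + dx H w * dx H w)).
  { intros w. unfold W_H, snd. rewrite norm_grad_sq. now rewrite (Rplus_comm (dx H w * dx H w)). }
  destruct z as [a b].
  rewrite (Rplus_comm (dx H (a, b) * dx H (a, b))) at 5 6 7 8.
  repeat split; apply is_derive_unique.
  - apply (is_derive_ext _ _ _ _ (fun t => eq_sym (E1 (t, b)))).
    exact (is_derive_over_sum_squares (fun t => dx H (t, b)) (fun t => dy H (t, b))
             a _ _ Dxx Dxy HN).
  - apply (is_derive_ext _ _ _ _ (fun t => eq_sym (E1 (a, t)))).
    exact (is_derive_over_sum_squares (fun t => dx H (a, t)) (fun t => dy H (a, t))
             b _ _ Dyx Dyy HN).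
  - apply (is_derive_ext _ _ _ _ (fun t => eq_sym (E2 (t, b)))).
    exact (is_derive_over_sum_squares (fun t => dy H (t, b)) (fun t => dx H (t, b))
             a _ _ Dxy Dxx HN').
  - apply (is_derive_ext _ _ _ _ (fun t => eq_sym (E2 (a, t)))).
    exact (is_derive_over_sum_squares (fun t => dy H (a, t)) (fun t => dx H (a, t))
             b _ _ Dyy Dyx HN').
Qed.

(** Replacing both mixed derivatives of [H] by the same value turns the three
    equations into identities of rational functions. *)
Lemma bracket_and_divergence (Om : R * R -> Prop) (H : R * R -> R) (z : R * R) :
  open Om -> is_Ck 2 Om H -> Om z -> slope H z 0 <> 0 ->
  bracket (V_H H) (W_H H) z = scal (mu_H H z) (V_H H z) /\
  mu_H H z = ((dy (dy H) z - dx (dx H) z) * dx H z ^ 2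
        - 4 * dy (dx H) z * dx H z * dy H z
        + (dx (dx H) z - dy (dy H) z) * dy H z ^ 2) / slope H z 0 ^ 2 /\
  mu_H H z = dilation H z.
Proof.
  intros HO HC2 Hz H0.
  destruct (W_H_partials Om H z (slope H z 0) HC2 Hz (slope_0 H z) H0)
    as [W1x [W1y [W2x W2y]]].
  assert (S : dx (dy H) z = dy (dx H) z) by exact (mixed_partials Om H z HO HC2 Hz).
  assert (V2x : dx (fun w => snd (V_H H w)) z = - dx (dx H) z) by apply Derive_opp.
  assert (V2y : dy (fun w => snd (V_H H w)) z = - dy (dx H) z) by apply Derive_opp.
  assert (W1 : fst (W_H H z) = dx H z / slope H z 0)
    by (unfold W_H, fst; now rewrite norm_grad_sq, slope_0).
  assert (W2 : snd (W_H H z) = dy H z / slope H z 0)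
    by (unfold W_H, snd; now rewrite norm_grad_sq, slope_0).
  assert (M : mu_H H z = ((dy (dy H) z - dx (dx H) z) * dx H z ^ 2
        - 4 * dy (dx H) z * dx H z * dy H z
        + (dx (dx H) z - dy (dy H) z) * dy H z ^ 2) / slope H z 0 ^ 2).
  { unfold mu_H, divergence. rewrite W1x, W2y, S.
    rewrite slope_0 in *. field. exact H0. }
  split; [|split; [exact M|]].
  - rewrite scal_pair, M. unfold bracket, dir_deriv.
    rewrite W1x, W1y, W2x, W2y, W1, W2, V2x, V2y.
    change (dx (fun w => fst (V_H H w)) z) with (dx (dy H) z).
    change (dy (fun w => fst (V_H H w)) z) with (dy (dy H) z).
    change (fst (V_H H z)) with (dy H z). change (snd (V_H H z)) with (- dx H z).
    rewrite S. unfold minus, plus, opp; simpl. unfold prod_plus, prod_opp; simpl.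
    unfold plus, opp; simpl. rewrite slope_0 in *. f_equal; field; exact H0.
  - rewrite M. unfold dilation, twist, curv. rewrite push_0, S.
    field. exact H0.
Qed.

(** * The derivative of the period function *)

Theorem lemma2 (Om : R * R -> Prop) (H : R * R -> R) (A : R * R -> Prop)
    (Om_open : open Om) (Om_conn : connected Om) (H_C3 : is_Ck 3 Om H)
    (A_annulus : period_annulus Om (V_H H) A)
    (grad_neq0 : forall z, A z -> norm (grad H z) <> 0) :
  normalizer A (V_H H) (W_H H) /\
  (forall z, A z -> bracket (V_H H) (W_H H) z = scal (mu_H H z) (V_H H z)) /\
  (forall z, A z ->
     mu_H H z =
       ((dy (dy H) z - dx (dx H) z) * dx H z ^ 2
        - 4 * dy (dx H) z * dx H z * dy H z
        + (dx (dx H) z - dy (dy H) z) * dy H z ^ 2)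
       / norm (grad H z) ^ 4) /\
  (forall h, (exists z, A z /\ H z = h) ->
     (exists g, is_solution Om (V_H H) g /\ A (g 0) /\ H (g 0) = h) /\
     forall g, is_solution Om (V_H H) g -> A (g 0) -> H (g 0) = h ->
       (forall z, orbit g z <-> A z /\ H z = h) /\
       minimal_period g (period_fun Om H A h) /\
       ex_RInt (fun t => mu_H H (g t)) 0 (period_fun Om H A h) /\
       is_derive (period_fun Om H A) h
         (RInt (fun t => mu_H H (g t)) 0 (period_fun Om H A h))).
Proof.
  destruct A_annulus as [A_open [A_conn [A_Om A_cyc]]].
  assert (HC2 : is_Ck 2 Om H) by now apply is_Ck_pred.
  assert (Reg : forall z, A z -> 0 < slope H z 0).
  { intros z Hz. rewrite slope_0, <- norm_grad_sq.
    generalize (grad_neq0 z Hz). intros. nra. }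
  pose proof (fun z Hz => bracket_and_divergence Om H z Om_open HC2 (A_Om z Hz)
                (Rgt_not_eq _ _ (Reg z Hz))) as BD.
  split; [|split; [|split]].
  - intros z Hz. destruct (BD z Hz) as [-> _].
    rewrite scal_pair. unfold wedge; simpl. ring.
  - intros z Hz. now apply BD.
  - intros z Hz. destruct (BD z Hz) as [_ [-> _]].
    rewrite slope_0, <- norm_grad_sq. f_equal. ring.
  - assert (Orb : forall p q, A p -> A q -> H p = H q -> same_orbit Om H p q).
    { intros p q. apply (level_set_single_orbit Om H Om_open HC2 A); auto. }
    assert (Per : forall g T, is_solution Om (V_H H) g -> A (g 0) ->
              minimal_period g T -> period_fun Om H A (H (g 0)) = T).
    { intros g T Hg Hg0 HT.
      unfold period_fun.
      destruct (epsilon_spec (inhabits 0) (fun tau => exists g', is_solution Om (V_H H) g' /\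
        A (g' 0) /\ H (g' 0) = H (g 0) /\ minimal_period g' tau))
        as [g' [Hg' [Hg0' [E HT']]]].
      { now exists T, g. }
      destruct (same_orbit_solution Om H Om_open HC2 g 0 (g' 0)) as [a Ha]; auto.
      apply (minimal_period_unique g' _ T HT').
      apply (minimal_period_shift g g' a T); [|exact HT].
      intros t. rewrite <- (Rplus_0_r t) at 1.
      now apply (solution_meet Om (V_H H) g' g 0 a Om_open (V_H_C1 Om H HC2)). }
    intros h [z0 [Hz0 Ez0]]. split.
    { destruct (cycle_through Om H A A_cyc Reg z0 Hz0) as [g [T [Hg [<- [HA _]]]]].
      exists g. auto. }
    intros g Hg Hg0 <-.
    destruct (solution_in_annulus Om H Om_open HC2 A A_cyc Reg g Hg Hg0) as [HA [T HT]].
    assert (Hpos : 0 < T) by apply HT.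
    rewrite (Per g T Hg Hg0 HT).
    assert (Emu : forall t, dilation H (g t) = mu_H H (g t)).
    { intros t. symmetry. now apply BD. }
    split; [|split; [exact HT|split]].
    + intros z. split.
      * intros [t <-]. split; [apply HA|]. apply (H_constant Om H Om_open HC2 g t Hg).
      * intros [Hz E]. apply (same_orbit_solution Om H Om_open HC2 g 0 z Hg). auto.
    + apply (ex_RInt_ext (fun t => dilation H (g t))); [intros t _; apply Emu|].
      apply (@ex_RInt_continuous R_CompleteNormedModule). intros t _.
      apply (continuous_dilation Om H HC2 g).
      * exact (is_derive_continuous_pair _ _ _ (proj2 (Hg t))).
      * apply Hg.
      * apply Rgt_not_eq, Reg, HA.
    (* The tube around [g] identifies the period at the level [H (g 0) + x]. *)
    + rewrite <- (RInt_ext (fun t => dilation H (g t))) by (intros t _; apply Emu).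
      apply is_derive_Reals. intros eps Heps.
      destruct (tube Om H Om_open HC2 A A_open A_Om A_cyc Reg g T A (eps / 2) Hg HA HT
                  A_open HA ltac:(lra)) as [d [e [_ [He [_ Lev]]]]].
      exists (mkposreal e He). simpl. intros x Hx Hxe.
      destruct (Lev (H (g 0) + x)) as [g' [P [Hg' [HA' [E [_ [_ [HP Est]]]]]]]].
      { now replace (H (g 0) + x - H (g 0)) with x by ring. }
      rewrite <- E, (Per g' P Hg' HA' HP), (Per g T Hg Hg0 HT).
      replace (H (g 0) + x - H (g 0)) with x in Est by ring.
      assert (Hax : 0 < Rabs x) by now apply Rabs_pos_lt.
      apply (Rmult_lt_reg_r (Rabs x)); [exact Hax|].
      rewrite <- Rabs_mult.
      replace (((P - T) / x - RInt (fun t => dilation H (g t)) 0 T) * x) with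
        (P - T - x * RInt (fun t => dilation H (g t)) 0 T) by (field; exact Hx).
      nra.
Qed.
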